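(* Let $n\ge2$ and let $\gamma\in C^\infty([a,b];\mathbb{R}^n)$ be an arc-length parametrized curve with unit tangent $T=\gamma'$, bending stiffness $\varrho\in C^\infty([a,b];\mathbb{R}_{>0})$ and curvature function $\kappa$. Then $\gamma$ is elastic with bending stiffness $\varrho$ if and only if there is a constant vector $\mathbf a\in\mathbb{R}^n$ such that $$\varrho T''+\varrho'T'-\varrho\langle T'',T\rangle T=\mathbf a-\langle\mathbf a,T\rangle T,\qquad( * )$$ and in this case the pointwise multiplier is given by $$\Lambda=\tfrac12\varrho\langle T',T'\rangle-\langle\mathbf a,T\rangle=\tfrac12\varrho\langle\kappa,\kappa\rangle-\langle\mathbf a,T\rangle;$$ that is, a function $\Lambda\in C^\infty([a,b];\mathbb{R})$ is a pointwise multiplier for $\gamma$ if and only if it has this form for some $\mathbf a\in\mathbb{R}^n$ satisfying $( * )$. If $\varrho$ is constant, then $\Lambda$ is constant.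
   Context: A curve is a map $\gamma\in C^\infty([a,b];\mathbb{R}^n)$ with $\gamma'\ne0$ everywhere; it is arc-length parametrized if $|\gamma'|\equiv1$. For a function $g$ along $\gamma$, $\frac{dg}{ds}:=g'/|\gamma'|$ and $ds=|\gamma'|\,dx$; $T:=\frac{d\gamma}{ds}$. The bending energy of $\gamma$ with bending stiffness $\varrho\in C^\infty([a,b];\mathbb{R}_{>0})$ is $\mathcal B_\varrho(\gamma):=\frac12\int_a^b\varrho\,\langle\frac{dT}{ds},\frac{dT}{ds}\rangle\,ds$ ($\varrho$ is a fixed function on $[a,b]$, not varied). A smooth variation of $\gamma$ is a smooth one-parameter family $\gamma_t$, $t\in[-\epsilon,\epsilon]$, with $\gamma_0=\gamma$; its variational vector field is $\mathring\gamma:=\frac{d}{dt}|_{t=0}\gamma_t$, and for a functional $\mathcal F$, $d\mathcal F(\mathring\gamma):=\frac{d}{dt}|_{t=0}\mathcal F(\gamma_t)$. $C_0^\infty([a,b];\mathbb{R}^n)$ denotes the smooth maps with compact support in the interior of $[a,b]$. Variations and variational vector fields are treated as synonyms. An arc-length parametrized curve $\gamma$ with bending stiffness $\varrho$ is called elastic with bending stiffness $\varrho$ if it is a critical point of $\mathcal B_\varrho$ under all variations $\mathring\gamma\in C_0^\infty([a,b];\mathbb{R}^n)$ constraining the arc-length, i.e. $d\mathcal B_\varrho(\mathring\gamma)=0$ for all $\mathring\gamma\in C_0^\infty([a,b];\mathbb{R}^n)$ satisfying pointwise $\langle\mathring\gamma',\gamma'\rangle=0$. A pointwise multiplier for an elastic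 curve $\gamma$ is a function $\Lambda\in C^\infty([a,b];\mathbb{R})$ for which the Euler-Lagrange equation $$\varrho T'''+3\varrho\langle T',T''\rangle T+\tfrac32\varrho\langle T',T'\rangle T'+\varrho''T'+2\varrho'T''+\tfrac32\varrho'\langle T',T'\rangle T-\Lambda'T-\Lambda T'=0$$ holds. Curvature function: a normal field $Z$ along $\gamma$ is parallel if $Z'=\lambda T$ for some smooth function $\lambda$. Let $N=[N_1,\dots,N_{n-1}]$ be made of parallel unit normal fields along $\gamma$ with $\det(T,N_1,\dots,N_{n-1})=1$. The curvature function $\kappa\in C^\infty([a,b];\mathbb{R}^{n-1})$ is defined by $T'=-N\kappa$. *)

(* Defs.v *)
(* An element of C^oo([a, b]; V) is represented by a smooth function R -> V, of
   which only the restriction to [a, b] matters: every function smooth up to the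
   boundary of [a, b] extends smoothly to R, and its derivatives on [a, b],
   endpoints included, do not depend on the extension.  All conditions below are
   therefore imposed on [a, b] only.  One-parameter families, smooth on
   [-e, e] x [a, b], are treated in the same way. *)
From HB Require Import structures.
From mathcomp Require Import all_boot all_order all_algebra.
From mathcomp Require Import all_classical all_reals all_analysis.
Import Order.TTheory GRing.Theory Num.Theory.
Import numFieldNormedType.Exports.

Set Implicit Arguments.
Unset Strict Implicit.
Unset Printing Implicit Defensive.

Local Open Scope classical_set_scope.
Local Open Scope ring_scope.

(* In [ring_scope] these notations otherwise denote derivatives of polynomials. *)
Local Notation "f ^` ()" := (derive1 f) : ring_scope.
Local Notation "f ^` ( k )" := (derive1n k f) : ring_scope.

(* The library norm [`|u|] on matrices is the sup norm, not the Euclidean one. *)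
Definition dot (R : realType) (n : nat) (u v : 'cV[R]_n) : R :=
  \sum_(i < n) u i 0 * v i 0.

Definition enorm (R : realType) (n : nat) (u : 'cV[R]_n) : R :=
  Num.sqrt (dot u u).

Definition smooth (R : realType) (V : normedModType R) (f : R -> V) : Prop :=
  forall (k : nat) (x : R), derivable (f^`(k)) x 1.

(* Class C^k of a map (t, x) |-> F t x: all iterated partial derivatives of
   order at most k exist and are jointly continuous. *)
Fixpoint C2 (R : realType) (V : normedModType R) (k : nat) (F : R -> R -> V)
    : Prop :=
  continuous (fun p : R * R => F p.1 p.2) /\
  if k is k'.+1 then
    [/\ forall t x, derivable (fun s => F s x) t 1,
        forall t x, derivable (F t) x 1,
        C2 k' (fun t x => (fun s => F s x)^`() t)
      & C2 k' (fun t x => (F t)^`() x)]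
  else True.

Definition smooth2 (R : realType) (V : normedModType R) (F : R -> R -> V)
    : Prop :=
  forall k : nat, C2 k F.

Definition is_curve (R : realType) (n : nat) (a b : R) (g : R -> 'cV[R]_n)
    : Prop :=
  smooth g /\ (forall x, a <= x <= b -> g^`() x != 0).

Definition arclength_parametrized (R : realType) (n : nat) (a b : R)
    (g : R -> 'cV[R]_n) : Prop :=
  is_curve a b g /\ (forall x, a <= x <= b -> enorm (g^`() x) = 1).

Definition is_stiffness (R : realType) (a b : R) (rho : R -> R) : Prop :=
  smooth rho /\ (forall x, a <= x <= b -> 0 < rho x).

(* dh/ds = h' / |g'| for a function h along the curve g. *)
Definition dds (R : realType) (n : nat) (g h : R -> 'cV[R]_n) : R -> 'cV[R]_n :=
  fun x => (enorm (g^`() x))^-1 *: h^`() x.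

Definition unit_tangent (R : realType) (n : nat) (g : R -> 'cV[R]_n)
    : R -> 'cV[R]_n :=
  dds g g.

Definition bending_energy (R : realType) (n : nat) (a b : R) (rho : R -> R)
    (g : R -> 'cV[R]_n) : R :=
  let dT := dds g (unit_tangent g) in
  2^-1 * \int[@lebesgue_measure R]_(x in `[a, b])
           (rho x * dot (dT x) (dT x) * enorm (g^`() x)).

(* [G] is a smooth variation g_t = G t (t in [-e, e]) of [g]. *)
Definition is_variation (R : realType) (n : nat) (a b : R)
    (g : R -> 'cV[R]_n) (e : R) (G : R -> R -> 'cV[R]_n) : Prop :=
  [/\ 0 < e, smooth2 G, forall x, a <= x <= b -> G 0 x = g x
    & forall t, - e <= t <= e -> is_curve a b (G t)].

Definition variational_field (R : realType) (n : nat)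
    (G : R -> R -> 'cV[R]_n) : R -> 'cV[R]_n :=
  fun x => (fun t => G t x)^`() 0.

(* C_0^oo([a, b]; R^n): the support is closed and bounded, so that it is compact
   in the interior as soon as it is contained in ]a, b[. *)
Definition smooth_compact_support (R : realType) (n : nat) (a b : R)
    (V : R -> 'cV[R]_n) : Prop :=
  smooth V /\
  closure [set x | a <= x <= b /\ V x != 0] `<=` [set` `]a, b[].

(* Critical points of the bending energy under the variations constraining the
   arc-length: for each admissible field V, dB(V) = d/dt B(g_t) at t = 0 vanishes
   whatever the variation g_t with variational field V. *)
Definition is_elastic (R : realType) (n : nat) (a b : R) (rho : R -> R)
    (g : R -> 'cV[R]_n) : Prop :=
  arclength_parametrized a b g /\
  forall V : R -> 'cV[R]_n,
    smooth_compact_support a b V ->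
    (forall x, a <= x <= b -> dot (V^`() x) (g^`() x) = 0) ->
    forall (e : R) (G : R -> R -> 'cV[R]_n),
      is_variation a b g e G ->
      (forall x, a <= x <= b -> variational_field G x = V x) ->
      is_derive (0 : R) (1 : R) (fun t => bending_energy a b rho (G t)) (0 : R).

(* Left-hand side of the Euler-Lagrange equation, [T] being the unit tangent. *)
Definition EL (R : realType) (n : nat) (rho : R -> R) (T : R -> 'cV[R]_n)
    (L : R -> R) (x : R) : 'cV[R]_n :=
  rho x *: T^`(3) x
  + (3 * rho x * dot (T^`() x) (T^`(2) x)) *: T x
  + (3 / 2 * rho x * dot (T^`() x) (T^`() x)) *: T^`() x
  + rho^`(2) x *: T^`() x
  + (2 * rho^`() x) *: T^`(2) x
  + (3 / 2 * rho^`() x * dot (T^`() x) (T^`() x)) *: T x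
  - L^`() x *: T x
  - L x *: T^`() x.

Definition is_pointwise_multiplier (R : realType) (n : nat) (a b : R)
    (rho : R -> R) (g : R -> 'cV[R]_n) (L : R -> R) : Prop :=
  smooth L /\ (forall x, a <= x <= b -> EL rho g^`() L x = 0).

(* A unit normal field Z along g with Z' = l T for some smooth function l. *)
Definition parallel_unit_normal (R : realType) (n : nat) (a b : R)
    (g Z : R -> 'cV[R]_n) : Prop :=
  [/\ smooth Z,
      (forall x, a <= x <= b -> dot (Z x) (g^`() x) = 0 /\ enorm (Z x) = 1)
    & exists l : R -> R,
        smooth l /\ (forall x, a <= x <= b -> Z^`() x = l x *: g^`() x)].

(* The ambient dimension is n = m.+1, so that there are m = n - 1 normal fields:
   the columns of N, which together with the tangent make up the square matrix
   [T, N_1, ..., N_m]. *)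
Definition parallel_frame (R : realType) (m : nat) (a b : R)
    (g : R -> 'cV[R]_m.+1) (N : R -> 'M[R]_(m.+1, m)) : Prop :=
  (forall j : 'I_m, parallel_unit_normal a b g (fun x => col j (N x))) /\
  (forall x, a <= x <= b -> \det (row_mx (g^`() x) (N x) : 'M[R]_m.+1) = 1).

Definition is_curvature_function (R : realType) (m : nat) (a b : R)
    (g : R -> 'cV[R]_m.+1) (kappa : R -> 'cV[R]_m) : Prop :=
  smooth kappa /\
  exists N : R -> 'M[R]_(m.+1, m),
    parallel_frame a b g N /\
    (forall x, a <= x <= b -> g^`(2) x = - (N x *m kappa x)).

(* The normal parts of (rho T')' and of the constant vector v agree. *)
Definition elastic_equation (R : realType) (n : nat) (a b : R) (rho : R -> R)
    (T : R -> 'cV[R]_n) (v : 'cV[R]_n) : Prop :=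
  (forall x, a <= x <= b ->
    rho x *: T^`(2) x + rho^`() x *: T^`() x
      - (rho x * dot (T^`(2) x) (T x)) *: T x
    = v - dot v (T x) *: T x).

(* Main.v *)
(* For a variation with field V such that <V', T> = 0, the first variation of the
   bending energy is \int rho <T', V''>, the variation of the length element
   dropping out.  Writing W = V', elasticity says that the functional
   W |-> \int rho <T', W'>, on the compactly supported W orthogonal to T, vanishes
   on the common kernel of the n functionals \int W_i; it is therefore
   \int <v, W> for a constant vector v, and integrating by parts shows that the
   normal part of (rho T')' + v vanishes.  Conversely, if the normal parts of
   (rho T')' and v agree, then rho <T', V''> is the derivative of
   rho <T', V'> - <v, V>.

   The Euler-Lagrange expression is the derivative of
   rho T'' + rho' T' + (3/2 rho |T'|^2 - L) T, so it vanishes iff this vector is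
   constant, and its tangential part then determines L.  Finally |T'| = |kappa|
   because a matrix with unit columns and determinant 1 is orthogonal, by the
   equality case of Hadamard's inequality. *)
Require Import Defs.
From HB Require Import structures.
From mathcomp Require Import all_boot all_order all_algebra.
From mathcomp Require Import all_classical all_reals all_analysis.
From mathcomp Require Import ring lra.
Import Order.TTheory GRing.Theory Num.Theory.
Import numFieldNormedType.Exports.
Set Implicit Arguments.
Unset Strict Implicit.
Unset Printing Implicit Defensive.
Local Open Scope classical_set_scope.
Local Open Scope ring_scope.

(* In [ring_scope] these notations otherwise denote derivatives of polynomials. *)
Local Notation "f ^` ()" := (derive1 f) : ring_scope.
Local Notation "f ^` ( k )" := (derive1n k f) : ring_scope.

(** * Linear algebra *)

Section dot_theory.
Context {R : realType} {n : nat}.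
Implicit Types u v w : 'cV[R]_n.

Lemma dotC u v : dot u v = dot v u.
Proof. by apply: eq_bigr => i _; rewrite mulrC. Qed.

Lemma dotDl u v w : dot (u + v) w = dot u w + dot v w.
Proof. by rewrite -big_split; apply: eq_bigr => i _; rewrite mxE mulrDl. Qed.

Lemma dotZl c u v : dot (c *: u) v = c * dot u v.
Proof. by rewrite mulr_sumr; apply: eq_bigr => i _; rewrite mxE mulrA. Qed.

Lemma dotNl u v : dot (- u) v = - dot u v.
Proof. by rewrite -scaleN1r dotZl mulN1r. Qed.

Lemma dotDr u v w : dot w (u + v) = dot w u + dot w v.
Proof. by rewrite dotC dotDl !(dotC w). Qed.

Lemma dotZr c u v : dot u (c *: v) = c * dot u v.
Proof. by rewrite dotC dotZl dotC. Qed.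

Lemma dotNr u v : dot u (- v) = - dot u v.
Proof. by rewrite dotC dotNl dotC. Qed.

Lemma dot0l u : dot 0 u = 0.
Proof. by rewrite -(scale0r u) dotZl mul0r. Qed.

Lemma dot0r u : dot u 0 = 0.
Proof. by rewrite dotC dot0l. Qed.

Lemma dot_ge0 u : 0 <= dot u u.
Proof. by apply: sumr_ge0 => i _; rewrite -expr2 sqr_ge0. Qed.

Lemma dot_eq0 u : (dot u u == 0) = (u == 0).
Proof.
apply/eqP/eqP => [|->]; last by rewrite dot0l.
move=> /psumr_eq0P u0; apply/colP => i; rewrite mxE; apply/eqP.
have /eqP := u0 (fun i _ => eq_ind_r (fun x => 0 <= x) (sqr_ge0 _) (esym (expr2 _))) i isT.
by rewrite mulf_eq0 orbb.
Qed.

Lemma dot_mx u v : u^T *m v = (dot u v)%:M.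
Proof.
apply/matrixP => i j; rewrite !ord1 !mxE mulr1n.
by apply: eq_bigr => k _; rewrite mxE.
Qed.

Lemma enorm_gt0 u : (0 < enorm u) = (u != 0).
Proof. by rewrite sqrtr_gt0 lt_def dot_eq0 dot_ge0 andbT. Qed.

Lemma enorm_eq1 u : enorm u = 1 -> dot u u = 1.
Proof. by move=> u1; rewrite -[LHS]sqr_sqrtr ?dot_ge0// -/(enorm u) u1 expr1n. Qed.

Definition dotE := (dotDl, dotDr, dotNl, dotNr, dotZl, dotZr).

End dot_theory.


(** * Gram matrices and the equality case of Hadamard's inequality *)

Section gram.
Context {R : realType}.

Lemma tr_mul_row (p m1 m2 : nat) (A : 'M[R]_(p, m1)) (B : 'M[R]_(p, m2)) :
  (row_mx A B)^T *m row_mx A B =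
  block_mx (A^T *m A) (A^T *m B) (B^T *m A) (B^T *m B).
Proof. by rewrite tr_row_mx mul_col_row. Qed.

Lemma gram_diag (p n : nat) (B : 'M[R]_(p, n)) j :
  (B^T *m B) j j = dot (col j B) (col j B).
Proof. by rewrite !mxE; apply: eq_bigr => k _; rewrite !mxE. Qed.

(* By induction, replacing the last [n] columns by their components orthogonal to
   the first one. *)
Lemma hadamard (p n : nat) (B : 'M[R]_(p, n)) :
  (forall j, dot (col j B) (col j B) <= 1) ->
  \det (B^T *m B) <= 1 /\ (\det (B^T *m B) = 1 -> B^T *m B = 1%:M).
Proof.
elim: n B => [B _|n IH].
  by rewrite det_mx00; split=> // _; apply/matrixP => -[].
rewrite -[n.+1]/(1 + n)%N => B B1.
set a : 'cV[R]_p := lsubmx B; set C : 'M[R]_(p, n) := rsubmx B.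
have BE : B = row_mx a C by rewrite hsubmxK.
have a1 : dot a a <= 1.
  have a0 : col 0 a = a by apply/colP => i; rewrite mxE.
  by have := B1 (lshift n 0); rewrite BE colKl a0.
have C1 j : dot (col j C) (col j C) <= 1 by have := B1 (rshift 1 j); rewrite BE colKr.
(* A zero first column makes the Gram determinant vanish: the bound is trivial and the equality case
   is void. *)
have [a0|a0] := eqVneq a 0.
  have -> : \det (B^T *m B) = 0.
    rewrite BE tr_mul_row a0 trmx0 !mul0mx mulmx0.
    by rewrite det_lblock det0 ?mul0r//.
  by split=> // /esym/eqP; rewrite oner_eq0.
have s0 : 0 < dot a a by rewrite lt_def dot_eq0 a0 dot_ge0.
set s := dot a a in a1 s0.
(* The entries of [r] are minus the projection coefficients of the columns of [C] on [a], so that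
   [D] is one Gram-Schmidt step applied to [C]. *)
pose r : 'rV[R]_n := - s^-1 *: (a^T *m C).
pose D := a *m r + C.
have aD : a^T *m D = 0.
  rewrite /D mulmxDr mulmxA dot_mx -/s mul_scalar_mx /r scalerA mulrN divff ?gt_eqF//.
  by rewrite scaleN1r addNr.
have D1 j : dot (col j D) (col j D) = dot (col j C) (col j C) - s^-1 * dot a (col j C) ^+ 2.
  have -> : col j D = col j C - (s^-1 * dot a (col j C)) *: a.
    apply/colP => i; rewrite !mxE big_ord1 !mxE addrC; congr (_ + _).
    rewrite mulrC -mulNr; congr (_ * _); rewrite mulNr; congr (- (_ * _)).
    by apply: eq_bigr => k _; rewrite !mxE.
  rewrite !dotE (dotC _ a) -/s.
  field; exact: lt0r_neq0.
(* Passing from [C] to [D] is right multiplication by a unipotent matrix, which preserves the Gram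
   determinant; orthogonality of [a] and [D] then makes the Gram matrix block diagonal. *)
have detB : \det (B^T *m B) = s * \det (D^T *m D).
  pose U : 'M[R]_(1 + n) := block_mx 1%:M r 0 1%:M.
  have dU : \det U = 1 by rewrite det_ublock !det1 mulr1.
  have BU : B *m U = row_mx a D.
    by rewrite BE mul_row_block !mulmx1 mulmx0 addr0.
  have -> : \det (B^T *m B) = \det ((B *m U)^T *m (B *m U)).
    by rewrite trmx_mul mulmxA !det_mulmx -(mulmxA _ _ B) !det_mulmx det_tr dU !mul1r mulr1.
  rewrite BU tr_mul_row aD -[D^T *m a]trmxK trmx_mul trmxK aD trmx0 det_ublock.
  by rewrite dot_mx det_scalar1.
have s1 : s^-1 > 0 by rewrite invr_gt0.
have D1' j : dot (col j D) (col j D) <= 1.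
  by rewrite D1; apply: le_trans (C1 j); rewrite gerBl mulr_ge0 ?sqr_ge0// ltW.
have [dD eD] := IH D D1'.
(* Splitting on the sign avoids proving that Gram determinants are nonnegative: in the nonpositive
   case the product is at most 0, hence different from 1. *)
have [dD0|dD0] := ltP 0 (\det (D^T *m D)); last first.
  have le0 : \det (B^T *m B) <= 0 by rewrite detB pmulr_rle0.
  split; first exact: le_trans le0 ler01.
  by move=> E; move: le0; rewrite E ler10.
have le1 : \det (B^T *m B) <= 1 by rewrite detB mulr_ile1// ltW.
split=> // E.
have sE : s = 1.
  apply/eqP; rewrite eq_le a1/= -E detB ger_pMr//.
have dE : \det (D^T *m D) = 1 by move: E; rewrite detB sE mul1r.
have DD := eD dE.
(* The column of [D] has squared length 1 = |C_j|^2 - <a, C_j>^2 with |C_j| at most 1, which leaves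
   no room for the square. *)
have aC j : dot a (col j C) = 0.
  have := D1 j; rewrite -(gram_diag D) DD mxE eqxx sE invr1 mul1r => h.
  apply/eqP; rewrite -sqrf_eq0 eq_le sqr_ge0 andbT.
  by have := C1 j; move: h => /=; rewrite mulr1n; lra.
have r0 : r = 0.
  apply/rowP => j; rewrite mxE [RHS]mxE (_ : (a^T *m C) 0 j = dot a (col j C)).
    by rewrite aC mulr0.
  by rewrite mxE; apply: eq_bigr => k _; rewrite !mxE.
have DC : D = C by rewrite /D r0 mulmx0 add0r.
rewrite DC in aD DD.
rewrite BE tr_mul_row aD DD -[C^T *m a]trmxK trmx_mul trmxK aD trmx0 dot_mx.
by rewrite -/s sE -scalar_mx_block.
Qed.

(** The Gram determinant is (det A)^2 = 1, so the equality case of Hadamard's inequality applies. *)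
Lemma unit_columns_orthonormal (n : nat) (A : 'M[R]_n) :
  (forall j, dot (col j A) (col j A) = 1) -> \det A = 1 -> A^T *m A = 1%:M.
Proof.
move=> A1 dA; apply: (hadamard _).2; first by move=> j; rewrite A1.
by rewrite det_mulmx det_tr dA mulr1.
Qed.

End gram.

(** * Linear functionals vanishing on a common kernel *)

Section functionals.
Context {R : realType} {V : lmodType R}.

(** Induction on the number of functionals, restricting to the kernel of the last one. The subspace
    is a predicate [X] and linearity is asked on [X] only, because integrals are additive only on
    suitable functions. *)
Lemma functional_span (n : nat) (X : V -> Prop) (f : 'I_n -> V -> R) (l : V -> R) :
  (forall c u v, X u -> X v -> X (c *: u + v)) ->
  (forall i c u v, X u -> X v -> f i (c *: u + v) = c * f i u + f i v) ->
  (forall c u v, X u -> X v -> l (c *: u + v) = c * l u + l v) ->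
  (forall u, X u -> (forall i, f i u = 0) -> l u = 0) ->
  exists v : 'I_n -> R, forall u, X u -> l u = \sum_i v i * f i u.
Proof.
elim: n X f => [|n IH] X f XL fL lL l0.
  by exists (fun=> 0) => u Xu; rewrite big_ord0; apply: l0 => // -[].
have [||||v Hv] := IH (fun u => X u /\ f ord_max u = 0)
  (fun i => f (lift ord_max i)).
- move=> c u v [Xu u0] [Xv v0]; split; first exact: XL.
  by rewrite fL// u0 v0 mulr0 addr0.
- by move=> i c u v [Xu _] [Xv _]; apply: fL.
- by move=> c u v [Xu _] [Xv _]; apply: lL.
- move=> u [Xu u0] uf; apply: l0 => // i.
  by case: (unliftP ord_max i) => [j ->|->].
have [[x0 [Xx0 fx0]]|H] := pselect (exists x0, X x0 /\ f ord_max x0 <> 0).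
(* The last coefficient [d] is the one making the formula true at [x0]; the multiple [k] of [x0]
   moves [u] into the kernel of the last functional, where the induction hypothesis holds. *)
- pose c := f ord_max x0.
  pose d := (l x0 - \sum_i v i * f (lift ord_max i) x0) / c.
  exists (fun i => if unlift ord_max i is Some j then v j else d) => u Xu.
  have cn0 : c != 0 by exact/eqP.
  pose k := - (f ord_max u / c).
  have := Hv (k *: x0 + u); rewrite lL//.
  under eq_bigr do rewrite fL// mulrDr mulrCA.
  rewrite big_split/= -mulr_sumr => Hu.
  rewrite (bigD1 ord_max)//= unlift_none.
  have -> : \sum_(i < n.+1 | i != ord_max)
       (if unlift ord_max i is Some j then v j else d) * f i u =
       \sum_i v i * f (lift ord_max i) u.
    rewrite big_mkcond big_ord_recr/= eqxx addr0; apply: eq_bigr => i _.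
    have -> : widen_ord (leqnSn n) i = lift ord_max i.
      by apply: val_inj; rewrite /= /bump leqNgt ltn_ord.
    by rewrite liftK eq_sym neq_lift.
  have : k * l x0 + l u = k * \sum_i v i * f (lift ord_max i) x0 +
      \sum_i v i * f (lift ord_max i) u.
    apply: Hu; split; first exact: XL.
    by rewrite fL// /k mulNr divfK// addNr.
  rewrite /k /d => e.
  apply/(addrI (- (f ord_max u / c) * l x0)); rewrite e; field; exact: cn0.
(* Here the last functional vanishes on all of [X], and its coefficient 0 is an arbitrary choice. *)
- exists (fun i => if unlift ord_max i is Some j then v j else 0) => u Xu.
  rewrite Hv; last by split=> //; apply: contrapT => h; apply: H; exists u.
  rewrite big_ord_recr/= unlift_none mul0r addr0; apply: eq_bigr => i _.
  have -> : widen_ord (leqnSn n) i = lift ord_max i.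
    by apply: val_inj; rewrite /= /bump leqNgt ltn_ord.
  by rewrite liftK.
Qed.

End functionals.

(** * Smooth functions *)

Section smooth_calculus.
Context {R : realType}.

(** Finite-order smoothness that peels off the innermost derivative, so that closure properties
    follow by induction on [k] with the function generalized. *)
Fixpoint nsmooth (V : normedModType R) (k : nat) (f : R -> V) : Prop :=
  (forall x, derivable f x 1) /\ if k is k'.+1 then nsmooth k' f^`() else True.

Lemma smoothP (V : normedModType R) (f : R -> V) :
  smooth f <-> forall k, nsmooth k f.
Proof.
split=> [fs k|fs k x].
  elim: k f fs => [|k IH] f fs; split=> //; try exact: (fs 0%N).
  by apply: IH => j x; rewrite -derive1Sn; apply: fs.
elim: k f fs => [|k IH] f fs; first exact: (fs 0%N).1.
by rewrite derive1Sn; apply: IH => j; exact: (fs j.+1).2.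
Qed.

Lemma smooth_derive1 (V : normedModType R) (f : R -> V) : smooth f -> smooth f^`().
Proof. by move=> /smoothP fs; apply/smoothP => k; exact: (fs k.+1).2. Qed.

Lemma smooth_derivable (V : normedModType R) (f : R -> V) (x : R) :
  smooth f -> derivable f x 1.
Proof. by move=> /(_ 0%N); exact. Qed.

Lemma is_derive1P (V : normedModType R) (f : R -> V) (x : R) :
  derivable f x 1 -> is_derive x 1 f (f^`() x).
Proof. by rewrite derive1E => /derivableP. Qed.

Lemma smooth_is_derive (V : normedModType R) (f : R -> V) (x : R) :
  smooth f -> is_derive x 1 f (f^`() x).
Proof. by move=> fs; apply/is_derive1P/smooth_derivable. Qed.

Lemma is_derive1E (V : normedModType R) (f : R -> V) (x : R) df :
  is_derive x 1 f df -> f^`() x = df.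
Proof. by move=> [_ <-]; rewrite derive1E. Qed.

Lemma is_derive_continuous (V : normedModType R) (f : R -> V) (x : R) df :
  is_derive x 1 f df -> {for x, continuous f}.
Proof. by move=> [? _]; apply: differentiable_continuous; exact/derivable1_diffP. Qed.

Lemma smooth_continuous (V : normedModType R) (f : R -> V) :
  smooth f -> continuous f.
Proof. by move=> fs x; apply/is_derive_continuous/smooth_is_derive. Qed.

Lemma smooth_cst (V : normedModType R) (c : V) : smooth (fun _ : R => c).
Proof.
apply/smoothP => k; elim: k c => [|k IH] c; split=> //; try by move=> x; exact: derivable_cst.
rewrite (_ : _^`() = fun=> 0); first exact: IH.
by apply/funext => x; rewrite derive1E derive_cst.
Qed.

Lemma nsmoothW (V : normedModType R) k (f : R -> V) : nsmooth k.+1 f -> nsmooth k f.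
Proof.
elim: k f => [|k IH] f [f1 f2]; split=> //.
exact: IH.
Qed.

Lemma nsmoothD (V : normedModType R) k (f g : R -> V) :
  nsmooth k f -> nsmooth k g -> nsmooth k (fun x => f x + g x).
Proof.
elim: k f g => [|k IH] f g [f1 f2] [g1 g2]; split; try by move=> x; exact: derivableD.
  by [].
rewrite (_ : _^`() = fun x => f^`() x + g^`() x); first exact: IH.
apply/funext => x; apply: is_derive1E.
by apply: is_deriveD; exact: is_derive1P.
Qed.

Lemma nsmoothM k (f g : R -> R) :
  nsmooth k f -> nsmooth k g -> nsmooth k (fun x => f x * g x).
Proof.
elim: k f g => [|k IH] f g fs gs.
  by case: fs => f1 _; case: gs => g1 _; split=> [x|//]; exact: (derivableM (f1 x) (g1 x)).
have fk := nsmoothW fs; have gk := nsmoothW gs.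
case: fs => f1 f2; case: gs => g1 g2; split.
  by move=> x; exact: (derivableM (f1 x) (g1 x)).
rewrite (_ : _^`() = fun x => f x * g^`() x + g x * f^`() x).
  by apply: nsmoothD; exact: IH.
apply/funext => x; apply: is_derive1E.
exact: (is_deriveM (is_derive1P (f1 x)) (is_derive1P (g1 x))).
Qed.

Lemma smoothD (V : normedModType R) (f g : R -> V) :
  smooth f -> smooth g -> smooth (fun x => f x + g x).
Proof. by move=> /smoothP fs /smoothP gs; apply/smoothP => k; exact: nsmoothD. Qed.

Lemma smoothM (f g : R -> R) :
  smooth f -> smooth g -> smooth (fun x => f x * g x).
Proof. by move=> /smoothP fs /smoothP gs; apply/smoothP => k; exact: nsmoothM. Qed.

Lemma smooth_sum (n : nat) (f : 'I_n -> R -> R) :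
  (forall i, smooth (f i)) -> smooth (fun x => \sum_i f i x).
Proof.
elim: n f => [|n IH] f fs.
  rewrite (_ : (fun x => _) = fun=> 0); first exact: smooth_cst.
  by apply/funext => x; rewrite big_ord0.
rewrite (_ : (fun x => _) = fun x => f ord0 x + \sum_i f (lift ord0 i) x).
  by apply: smoothD => //; exact: IH.
by apply/funext => x; rewrite big_ord_recl.
Qed.

Section vectors.
Context {n : nat}.
Implicit Types u v : R -> 'cV[R]_n.

Lemma is_derive_cV u (x : R) (du : 'cV[R]_n) :
  is_derive x 1 u du <-> forall i, is_derive x 1 (fun y => u y i 0) (du i 0).
Proof.
split=> [[ud uE] i|ud].
  split; first exact: (derivable_mxP _ _ _).1 ud i 0.
  by rewrite -uE (derive_mx ud) mxE.
have ud1 : derivable u x 1.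
  by apply/derivable_mxP => i j; rewrite (ord1 j); case: (ud i).
split=> //; rewrite (derive_mx ud1); apply/colP => i; rewrite mxE.
by case: (ud i).
Qed.

Lemma smooth_cV u : smooth u <-> forall i, smooth (fun y => u y i 0).
Proof.
split=> [/smoothP us i|us].
  apply/smoothP => k; elim: k u us => [|k IH] u us.
    by split=> // x; have /is_derive_cV/(_ i)[] := is_derive1P ((us 0%N).1 x).
  split.
    by move=> x; have /is_derive_cV/(_ i)[] := is_derive1P ((us 0%N).1 x).
  rewrite (_ : _^`() = fun y => u^`() y i 0).
    by apply: IH => j; exact: (us j.+1).2.
  apply/funext => x; apply: is_derive1E.
  by have /is_derive_cV/(_ i) := is_derive1P ((us 0%N).1 x).
apply/smoothP => k; elim: k u us => [|k IH] u us.
  by split=> // x; apply/derivable_mxP => i j; rewrite (ord1 j); exact: smooth_derivable.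
have ud x : derivable u x 1.
  by apply/derivable_mxP => i j; rewrite (ord1 j); exact: smooth_derivable.
split=> //; apply: IH => i.
rewrite (_ : (fun y => _) = (fun y => u y i 0)^`()); first exact: smooth_derive1.
apply/funext => x; apply/esym/is_derive1E.
by have /is_derive_cV/(_ i) := is_derive1P (ud x).
Qed.

Lemma derive1_coord u i (x : R) :
  smooth u -> (fun y => u y i 0)^`() x = u^`() x i 0.
Proof.
move=> us; apply: is_derive1E.
by have /is_derive_cV := smooth_is_derive x us; apply.
Qed.

Lemma smooth_dot u v : smooth u -> smooth v -> smooth (fun x => dot (u x) (v x)).
Proof.
move=> /smooth_cV us /smooth_cV vs; apply: smooth_sum => i; exact: smoothM (us i) (vs i).
Qed.

Lemma smoothZ (c : R -> R) u : smooth c -> smooth u -> smooth (fun x => c x *: u x).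
Proof.
move=> cs /smooth_cV us; apply/smooth_cV => i.
have -> : (fun y => (c y *: u y) i 0) = (fun y => c y * u y i 0).
  by apply/funext => y; rewrite mxE.
exact: smoothM cs (us i).
Qed.

Lemma smoothN u : smooth u -> smooth (fun x => - u x).
Proof.
move=> us; rewrite (_ : (fun x => _) = fun x => (- 1) *: u x).
  by apply: smoothZ us; exact: smooth_cst.
by apply/funext => x; rewrite scaleN1r.
Qed.

Lemma is_derive_dot u v (x : R) du dv :
  is_derive x 1 u du -> is_derive x 1 v dv ->
  is_derive x 1 (fun y => dot (u y) (v y)) (dot du (v x) + dot (u x) dv).
Proof.
move=> /is_derive_cV ud /is_derive_cV vd.
have -> : (fun y => dot (u y) (v y)) = \sum_(i < n) (fun y => u y i 0 * v y i 0).
  by apply/funext => y; rewrite fct_sumE.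
apply: (is_derive_eq (is_derive_sum (fun i => is_deriveM (ud i) (vd i)))).
rewrite -big_split; apply: eq_bigr => i _ /=.
by rewrite addrC; congr (_ + _); exact: mulrC.
Qed.

Lemma is_deriveZv (c : R -> R) u (x : R) dc du :
  is_derive x 1 c dc -> is_derive x 1 u du ->
  is_derive x 1 (fun y => c y *: u y) (dc *: u x + c x *: du).
Proof.
move=> cd /is_derive_cV ud; apply/is_derive_cV => i.
have -> : (fun y => (c y *: u y) i 0) = (fun y => c y * u y i 0).
  by apply/funext => y; rewrite mxE.
apply: (is_derive_eq (is_deriveM cd (ud i))).
by rewrite !mxE addrC; congr (_ + _); exact: mulrC.
Qed.

Lemma cvg_dot (T : Type) (F : set_system T) {FF : Filter F} (u v : T -> 'cV[R]_n) p q :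
  u @ F --> p -> v @ F --> q -> (fun y => dot (u y) (v y)) @ F --> dot p q.
Proof.
move=> up vq; apply: cvg_big => [|i _].
  by apply: add_continuous.
apply: cvgM.
  by apply: (@cvg_comp _ _ _ u (fun M : 'cV[R]_n => M i 0)) up _; exact: coord_continuous.
by apply: (@cvg_comp _ _ _ v (fun M : 'cV[R]_n => M i 0)) vq _; exact: coord_continuous.
Qed.

End vectors.

(** * Identities on a closed interval and their derivatives, endpoints included *)

Section closed_interval.
Variables (a b : R).
Hypothesis ab : a < b.

Lemma eq0_itvcc (h : R -> R) : continuous h ->
  (forall x, a < x < b -> h x = 0) -> forall x, a <= x <= b -> h x = 0.
Proof.
move=> hc h0 x /andP[]; rewrite le_eqVlt => /predU1P[<- _|ax].
  have hr : h y @[y --> a^'+] --> h a by apply: cvg_at_right_filter; exact: hc.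
  have h0' : h y @[y --> a^'+] --> (0 : R).
    apply: cvg_near_cst; near=> y; rewrite h0//; apply/andP; split; near: y.
      exact: nbhs_right_gt.
    exact: nbhs_right_lt.
  exact: cvg_unique hr h0'.
rewrite le_eqVlt => /predU1P[->|xb]; last by rewrite h0// ax.
have hr : h y @[y --> b^'-] --> h b by apply: cvg_at_left_filter; exact: hc.
have h0' : h y @[y --> b^'-] --> (0 : R).
  apply: cvg_near_cst; near=> y; rewrite h0//; apply/andP; split; near: y.
    exact: nbhs_left_gt.
  exact: nbhs_left_lt.
exact: cvg_unique hr h0'.
Unshelve. all: by end_near. Qed.

(** Inside the interval [h] vanishes near each point; at the endpoints, where nothing is known on
    the outer side, continuity of the derivative concludes. *)
Lemma derive1_eq0_itv (h : R -> R) : smooth h ->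
  (forall x, a <= x <= b -> h x = 0) -> forall x, a <= x <= b -> h^`() x = 0.
Proof.
move=> hs h0; apply: eq0_itvcc; first exact/smooth_continuous/smooth_derive1.
move=> x /andP[ax xb].
have : \forall y \near x, cst 0 y = h y.
  near=> y; rewrite h0//; apply/andP; split; apply/ltW; near: y.
    exact: lt_nbhsr.
  exact: lt_nbhsl.
move=> /near_eq_is_derive hd.
by apply: is_derive1E; apply: hd; exact: is_derive_cst.
Unshelve. all: by end_near. Qed.

Lemma derive1_eq_itv (h k : R -> R) : smooth h -> smooth k ->
  (forall x, a <= x <= b -> h x = k x) ->
  forall x, a <= x <= b -> h^`() x = k^`() x.
Proof.
move=> hs ks hk x xab; apply/eqP; rewrite -subr_eq0; apply/eqP.
have ksN : smooth (fun x => -1 * k x) by apply: smoothM ks; exact: smooth_cst.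
have hkE : is_derive x 1 (fun x => h x + -1 * k x) (h^`() x - k^`() x).
  apply: is_deriveD; first exact: smooth_is_derive.
  apply: (is_derive_eq (is_deriveM (is_derive_cst (-1 : R) x 1) (smooth_is_derive x ks))).
  by rewrite scaler0 addr0 scaleN1r.
rewrite -(is_derive1E hkE); apply: derive1_eq0_itv xab; first exact: smoothD.
by move=> y yab; rewrite hk// mulN1r subrr.
Qed.

Lemma derive1_eq_itv_cV n (u v : R -> 'cV[R]_n) : smooth u -> smooth v ->
  (forall x, a <= x <= b -> u x = v x) ->
  forall x, a <= x <= b -> u^`() x = v^`() x.
Proof.
move=> us vs uv x xab; apply/colP => i.
rewrite -!derive1_coord//; apply: derive1_eq_itv xab.
- exact: (smooth_cV _).1.
- exact: (smooth_cV _).1.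
- by move=> y yab; rewrite uv.
Qed.

Lemma derive1_0_cst_itv (h : R -> R) : smooth h ->
  (forall x, a <= x <= b -> h^`() x = 0) -> forall x, a <= x <= b -> h x = h a.
Proof.
move=> hs h0 x /andP[ax xb]; apply/eqP; rewrite -subr_eq0; apply/eqP.
have [| |c] := @MVT_segment R h h^`() a x ax.
- by move=> y _; exact: smooth_is_derive.
- by apply: continuous_subspaceT; exact: smooth_continuous.
rewrite in_itv/= => /andP[ac cx] ->.
by rewrite h0 ?mul0r// ac (le_trans cx).
Qed.

Lemma derive1_0_cst_itv_cV n (u : R -> 'cV[R]_n) : smooth u ->
  (forall x, a <= x <= b -> u^`() x = 0) -> forall x, a <= x <= b -> u x = u a.
Proof.
move=> us u0 x xab; apply/colP => i.
apply: (@derive1_0_cst_itv (fun y => u y i 0)) xab; first exact: (smooth_cV _).1.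
by move=> y yab; rewrite derive1_coord// u0// mxE.
Qed.

End closed_interval.
End smooth_calculus.

(** * Bump functions and primitives *)

Section bump.
Context {R : realType}.

Lemma exprn_le_expR (n : nat) : exists C : R, forall y : R, 0 <= y -> y ^+ n <= C * expR y.
Proof.
(* With z = y / (n + 1), the bound z <= 1 + z <= e^z gives z^n <= e^(nz) <= e^y. Dividing by n + 1
   rather than n covers n = 0. *)
exists (n.+1%:R ^+ n) => y y0.
pose z := y / n.+1%:R.
have z0 : 0 <= z by rewrite divr_ge0.
have -> : y = n.+1%:R * z by rewrite mulrC divfK// pnatr_eq0.
rewrite exprMn ler_wpM2l ?exprn_ge0//.
apply: (@le_trans _ _ (expR z ^+ n)).
  rewrite lerXn2r ?nnegrE ?expR_ge0//.
  by apply: le_trans (expR_ge1Dx z); rewrite lerDr.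
by rewrite -expRM_natl ler_expR ler_wpM2r// ler_nat.
Qed.

Lemma horner_le_expR (p : {poly R}) :
  exists C : R, forall y : R, 0 <= y -> `|p.[y]| <= C * expR y.
Proof.
(* The extra factor y^k absorbs the shift by X in the Horner recursion. *)
suff: forall k, exists C : R, forall y : R, 0 <= y -> `|p.[y] * y ^+ k| <= C * expR y.
  by move=> /(_ 0%N)[C HC]; exists C => y y0; have := HC y y0; rewrite expr0 mulr1.
elim/poly_ind: p => [|p c IH] k.
  by exists 0 => y _; rewrite horner0 !mul0r normr0.
have [C HC] := IH k.+1; have [D HD] := exprn_le_expR k.
exists (C + `|c| * D) => y y0; rewrite hornerMXaddC mulrDl.
rewrite (le_trans (ler_normD _ _))// mulrDl lerD//.
  by rewrite -mulrA -exprS; exact: HC.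
by rewrite normrM (ger0_norm (exprn_ge0 _ y0)) -mulrA ler_wpM2l// HD.
Qed.

(** The flat functions p(1/x) e^(-1/x), extended by 0 to x <= 0. Taking all polynomials [p] at once
    gives a family stable under differentiation. *)
Definition expinv (p : {poly R}) (x : R) : R :=
  if 0 < x then p.[x^-1] * expR (- x^-1) else 0.

(** The exponential bound for p X^2 at y = 1/x. A quadratic bound is what makes the derivative at 0
    exist and vanish. *)
Lemma expinv_sqr_bound (p : {poly R}) :
  exists C : R, forall x : R, `|expinv p x| <= C * x ^+ 2.
Proof.
have [C HC] := horner_le_expR (p * 'X^2).
have C0 : 0 <= C.
  have := HC 0 (lexx _); rewrite expR0 mulr1; exact: le_trans (normr_ge0 _).
exists C => x; rewrite /expinv; case: ifPn => [x0|_]; last first.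
  by rewrite normr0 mulr_ge0// sqr_ge0.
have := HC x^-1; rewrite invr_ge0 (ltW x0) => /(_ isT).
rewrite hornerM hornerXn normrM normrX normfV (gtr0_norm x0) => h.
rewrite normrM (gtr0_norm (expR_gt0 _)) expRN ler_pdivrMr ?expR_gt0//.
rewrite -mulrA (mulrC (x ^+ 2)) mulrA -ler_pdivrMr ?exprn_gt0//.
by rewrite -exprVn.
Qed.

Lemma is_derive_expinv (p : {poly R}) (x : R) :
  is_derive x 1 (expinv p) (expinv ('X^2 * (p - deriv p)) x).
Proof.
have [x0|x0|->] := ltgtP x 0.
- apply: (@near_eq_is_derive _ _ _ (cst 0)).
    near=> y; rewrite /expinv ifN// -leNgt; apply: ltW.
    by near: y; exact: lt_nbhsl.
  have -> : expinv ('X^2 * (p - deriv p)) x = 0 by rewrite /expinv ifN// lt_gtF.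
  exact: is_derive_cst.
- apply: (@near_eq_is_derive _ _ _ (fun y : R => p.[y^-1] * expR (- y^-1))).
    near=> y; rewrite /expinv ifT//.
    by near: y; exact: lt_nbhsr.
  have xn0 : x != 0 by rewrite gt_eqF.
  have dV : is_derive x 1 (fun y : R => y^-1) (- x ^- 2).
    apply: (is_derive_eq (@is_deriveV R id x 1 1 xn0 (is_derive_id x 1))).
    by rewrite /GRing.scale/= mulr1.
  have dp := @is_derive1_comp _ (horner p) (fun y => y^-1) x _ _ (is_derive_poly p x^-1) dV.
  have dN := is_deriveN dV.
  have de := @is_derive1_comp _ expR (fun y => - y^-1) x _ _ (is_derive_expR _) dN.
  apply: (is_derive_eq (is_deriveM dp de)).
  have -> : expinv ('X^2 * (p - deriv p)) x =
      x ^- 2 * (p.[x^-1] - (deriv p).[x^-1]) * expR (- x^-1).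
    by rewrite /expinv x0 hornerM hornerXn hornerD hornerN exprVn.
  by rewrite /GRing.scale/= opprK; ring.
(* At the origin the difference quotient is squeezed between 0 and C |h| in absolute value. *)
- have -> : expinv ('X^2 * (p - deriv p)) 0 = 0 by rewrite /expinv ltxx.
  have [C HC] := expinv_sqr_bound p.
  have e0 : expinv p 0 = 0 by rewrite /expinv ltxx.
  suff H : h^-1 *: (expinv p (h *: 1 + 0) - expinv p 0) @[h --> 0^'] --> (0 : R).
    by apply: DeriveDef; [apply/cvg_ex; exists 0|exact: cvg_lim H].
  apply/norm_cvg0P.
  apply: (@squeeze_cvgr _ _ _ _ (cst 0) (fun h => C * `|h|)).
  + near=> h; rewrite normr_ge0/= e0 subr0 addr0 scaler1 normrZ normfV.
    have h0 : h != 0 by near: h; exact: nbhs_dnbhs_neq.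
    rewrite mulrC ler_pdivrMr ?normr_gt0// -mulrA -expr2 real_normK ?num_real//.
  + exact: cvg_cst.
  + rewrite -[X in _ --> X](mulr0 C); apply: cvgM; first exact: cvg_cst.
    rewrite -[X in _ --> X](@normr0 _ R); apply: cvg_norm.
    exact: cvg_within.
Unshelve. all: by end_near. Qed.

Lemma smooth_expinv (p : {poly R}) : smooth (expinv p).
Proof.
apply/smoothP => k; elim: k p => [|k IH] p; split=> //.
- by move=> x; case: (is_derive_expinv p x).
- by move=> x; case: (is_derive_expinv p x).
rewrite (_ : _^`() = expinv ('X^2 * (p - deriv p))); first exact: IH.
apply/funext => x; apply: is_derive1E; exact: is_derive_expinv.
Qed.

Lemma smooth_affine (f : R -> R) (k c : R) : smooth f -> smooth (fun x => f (k * x + c)).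
Proof.
have D (h : R -> R) (x : R) : smooth h ->
    is_derive x 1 (fun y => h (k * y + c)) (h^`() (k * x + c) * k).
  move=> hs; have d : is_derive x 1 (fun y => k * y + c) k.
    have dk := is_deriveM (is_derive_cst k x 1) (is_derive_id x 1).
    apply: (is_derive_eq (is_deriveD dk (is_derive_cst c x 1))).
    by rewrite scaler0 !addr0 /GRing.scale/= mulr1.
  exact: (@is_derive1_comp _ h (fun y => k * y + c) x _ _ (smooth_is_derive _ hs) d).
move=> fs; apply/smoothP => j; elim: j f fs => [|j IH] f fs.
  by split=> [x|//]; case: (D f x fs).
split=> [x|]; first by case: (D f x fs).
have -> : (fun x => f (k * x + c))^`() = fun x => f^`() (k * x + c) * k.
  by apply/funext => x; apply: is_derive1E; exact: D.
have kc : smooth (fun _ : R => k) := @smooth_cst _ _ k.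
apply: nsmoothM; first exact/IH/smooth_derive1.
by move/smoothP : kc; apply.
Qed.

Lemma exists_bump (c d : R) : c < d ->
  exists phi : R -> R, [/\ smooth phi, forall x, 0 <= phi x,
    forall x, c < x < d -> 0 < phi x & forall x, ~~ (c < x < d) -> phi x = 0].
Proof.
move=> cd; pose E := expinv 1.
have E0 x : 0 < x -> 0 < E x by move=> x0; rewrite /E /expinv x0 hornerC mul1r expR_gt0.
have EN x : ~~ (0 < x) -> E x = 0 by move=> /negbTE x0; rewrite /E /expinv x0.
have Eg x : 0 <= E x.
  by have [/E0/ltW//|] := boolP (0 < x); move=> /EN ->.
(* The product E(x - c) E(d - x), with arguments written in the form expected by [smooth_affine]. *)
exists (fun x => E (1 * x - c) * E (-1 * x + d)); split.
- by apply: smoothM; apply: smooth_affine; exact: smooth_expinv.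
- by move=> x; rewrite mulr_ge0.
- by move=> x /andP[cx xd]; rewrite mulr_gt0// E0//; lra.
- move=> x; rewrite negb_and => /orP[h|h].
    by rewrite EN ?mul0r// mul1r subr_gt0.
  by rewrite mulrC EN ?mul0r// mulN1r addrC subr_gt0.
Qed.

End bump.

(** * Integrals over intervals and primitives *)

Section integrals.
Context {R : realType}.
Notation mu := (@lebesgue_measure R).

Lemma continuous_integrable_itv (a b : R) (f : R -> R) :
  {within `[a, b], continuous f} -> mu.-integrable `[a, b] (EFin \o f).
Proof. by apply: continuous_compact_integrable; exact: segment_compact. Qed.

Lemma Rintegral_derive (a b : R) (F f : R -> R) : a < b -> continuous f ->
  (forall x : R, is_derive x 1 F (f x)) -> \int[mu]_(x in `[a, b]) f x = F b - F a.
Proof.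
move=> ab fc Ff; rewrite /Rintegral (@continuous_FTC2 _ _ F)//.
- exact: continuous_subspaceT.
- split.
  + by move=> x _; case: (Ff x).
  + by apply: cvg_at_right_filter; exact: (is_derive_continuous (Ff a)).
  + by apply: cvg_at_left_filter; exact: (is_derive_continuous (Ff b)).
- by move=> x _; exact: is_derive1E.
Qed.

(** Integrating from a point to the left of [c] yields a primitive on the whole line: it is locally
    0 to the left of [c], and from [c] on the fundamental theorem applies at a point strictly beyond
    the lower bound. *)
Lemma primitive (c : R) (f : R -> R) : continuous f -> (forall x, x < c -> f x = 0) ->
  exists F : R -> R, (forall x : R, is_derive x 1 F (f x)) /\ forall x, x < c -> F x = 0.
Proof.
move=> fc f0; pose a := c - 1; have ac : a < c by rewrite /a; lra.
pose F x := \int[mu]_(t in `[a, x]) f t.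
have F0 x : x < c -> F x = 0.
  move=> xc; rewrite /F (@eq_Rintegral _ _ _ _ _ (cst 0)).
    by rewrite /Rintegral integral0.
  move=> y; rewrite inE/= in_itv/= => /andP[_ yx].
  by rewrite f0// (le_lt_trans yx).
exists F; split=> // x; have [xc|cx] := ltP x c.
  apply: (@near_eq_is_derive _ _ _ (cst 0)).
    near=> y; rewrite F0//; near: y; exact: lt_nbhsl.
  by rewrite f0//; exact: is_derive_cst.
have [] := @continuous_FTC1_closed R f a x (x + 1) _ _ _ _.
- by rewrite ltrDl.
- by apply: continuous_integrable_itv; exact: continuous_subspaceT.
- exact: lt_le_trans cx.
- exact: fc.
by move=> dF <-; exact: is_derive1P.
Unshelve. all: by end_near. Qed.

(** A primitive is nondecreasing on [a, b] with equal end values, hence constant there, and its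
    derivative [f] vanishes inside. *)
Lemma Rintegral_ge0_eq0 (a b c : R) (f : R -> R) : a < b -> continuous f ->
  (forall x, x < c -> f x = 0) ->
  (forall x, a <= x <= b -> 0 <= f x) -> \int[mu]_(x in `[a, b]) f x = 0 ->
  forall x, a < x < b -> f x = 0.
Proof.
move=> ab fc f0 fge0 If.
have [F [dF _]] := primitive fc f0.
have Fab : F b = F a by apply/eqP; rewrite -subr_eq0 -(Rintegral_derive ab fc dF) If.
have Fle x y : a <= x -> x <= y -> y <= b -> F x <= F y.
  move=> ax xy yb; rewrite -subr_ge0.
  have [|z] := @MVT_segment R F f x y xy (fun z _ => dF z).
    by apply: continuous_subspaceT => z; exact: is_derive_continuous (dF z).
  rewrite in_itv/= => /andP[xz zy] ->.
  by rewrite mulr_ge0 ?subr_ge0// fge0// (le_trans ax)//= (le_trans zy).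
move=> x /andP[ax xb].
rewrite -(is_derive1E (dF x)); apply: is_derive1E.
apply: (@near_eq_is_derive _ _ _ (cst (F a)) _ _ _ _ _ (is_derive_cst _ _ _)).
near=> y; have ay : a <= y by apply/ltW; near: y; exact: lt_nbhsr.
have yb : y <= b by apply/ltW; near: y; exact: lt_nbhsl.
by apply/eqP; rewrite eq_le Fle//= -Fab Fle.
Unshelve. all: by end_near. Qed.

End integrals.

(** * Functions of two variables *)

Section two_variables.
Context {R : realType}.

Definition partial_t (V : normedModType R) (F : R -> R -> V) : R -> R -> V :=
  fun t x => (fun s => F s x)^`() t.

Definition partial_x (V : normedModType R) (F : R -> R -> V) : R -> R -> V :=
  fun t x => (F t)^`() x.

Section smooth2_theory.
Variables (V : normedModType R) (F : R -> R -> V).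
Hypothesis Fs : smooth2 F.

Lemma smooth2_continuous : continuous (fun p : R * R => F p.1 p.2).
Proof. exact: (Fs 0%N).1. Qed.

Lemma smooth2_partial_t : smooth2 (partial_t F).
Proof. by move=> k; case: (Fs k.+1) => _ [_ _]. Qed.

Lemma smooth2_partial_x : smooth2 (partial_x F).
Proof. by move=> k; case: (Fs k.+1) => _ [_ _]. Qed.

Lemma is_derive_partial_t (t x : R) : is_derive t 1 (fun s => F s x) (partial_t F t x).
Proof. by apply: is_derive1P; case: (Fs 1%N) => _ []. Qed.

Lemma is_derive_partial_x (t x : R) : is_derive x 1 (F t) (partial_x F t x).
Proof. by apply: is_derive1P; case: (Fs 1%N) => _ []. Qed.

End smooth2_theory.

Lemma smooth2_smooth (V : normedModType R) (F : R -> R -> V) :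
  smooth2 F -> forall t, smooth (F t).
Proof.
move=> Fs t; apply/smoothP => k; elim: k F Fs => [|k IH] F Fs.
  by split=> [x|//]; case: (is_derive_partial_x Fs t x).
split=> [x|]; first by case: (is_derive_partial_x Fs t x).
exact: (IH (partial_x F) (smooth2_partial_x Fs)).
Qed.

(** Two applications of the mean value theorem: in the first variable to s |-> F(s, x + h) - F(s,
    x), then in the second variable to [Ft s]. *)
Lemma second_difference (F Ft Ftx : R -> R -> R) (t x h : R) : 0 <= h ->
  (forall s y : R, is_derive s 1 (fun s => F s y) (Ft s y)) ->
  (forall s y : R, is_derive y 1 (Ft s) (Ftx s y)) ->
  exists s y, [/\ t <= s <= t + h, x <= y <= x + h &
    F (t + h) (x + h) - F (t + h) x - (F t (x + h) - F t x) = Ftx s y * h * h].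
Proof.
move=> h0 dF dFt.
have th : t <= t + h by rewrite lerDl.
have xh : x <= x + h by rewrite lerDl.
pose d s := F s (x + h) - F s x.
have dd (s : R) : is_derive s 1 d (Ft s (x + h) - Ft s x) by apply: is_deriveB.
have dc : {within `[t, t + h], continuous d}.
  by apply: continuous_subspaceT => s; exact: is_derive_continuous (dd s).
have [s st dE] := MVT_segment th (fun s _ => dd s) dc.
have Fc : {within `[x, x + h], continuous (Ft s)}.
  by apply: continuous_subspaceT => y; exact: is_derive_continuous (dFt s y).
have [y yx FE] := MVT_segment xh (fun y _ => dFt s y) Fc.
exists s, y; split; rewrite ?in_itv//.
by rewrite -/(d (t + h)) -/(d t) dE FE !(addrC _ h) !addrK.
Qed.

Lemma continuous_box (f : R -> R -> R) (t x e : R) : 0 < e ->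
  {for (t, x), continuous (fun p : R * R => f p.1 p.2)} ->
  exists2 d, 0 < d & forall s y, t <= s <= t + d -> x <= y <= x + d ->
    `|f t x - f s y| < e.
Proof.
move=> e0 /cvgrPdist_lt /(_ e e0) /nbhs_ballP[d /= d0 H].
exists (d / 2); first exact: divr_gt0.
move=> s y sd yd; apply: (H (s, y)); split; rewrite /ball/= ltr_distlC; lra.
Qed.

(** The second difference over a square of side h is symmetric in the two variables, so it is h^2
    times a value of either mixed derivative; by continuity both values are close to those at (t,
    x). *)
Lemma schwarz (F Ft Fx Ftx Fxt : R -> R -> R) (t x : R) :
  (forall s y : R, is_derive s 1 (fun s => F s y) (Ft s y)) ->
  (forall s y : R, is_derive y 1 (F s) (Fx s y)) ->
  (forall s y : R, is_derive y 1 (Ft s) (Ftx s y)) ->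
  (forall s y : R, is_derive s 1 (fun s => Fx s y) (Fxt s y)) ->
  {for (t, x), continuous (fun p : R * R => Ftx p.1 p.2)} ->
  {for (t, x), continuous (fun p : R * R => Fxt p.1 p.2)} ->
  Ftx t x = Fxt t x.
Proof.
move=> dt dx dtx dxt ctx cxt; apply/eqP; rewrite -subr_eq0 -normr_le0.
apply/ler_addgt0Pl => e e0; rewrite addr0.
have e2 : 0 < e / 2 by rewrite divr_gt0.
have [d1 d10 H1] := continuous_box e2 ctx.
have [d2 d20 H2] := continuous_box e2 cxt.
pose h := Num.min d1 d2.
have h0 : 0 < h by rewrite lt_min d10.
have hd1 : h <= d1 by rewrite ge_min lexx.
have hd2 : h <= d2 by rewrite ge_min lexx orbT.
have [s1 [y1 [s1t y1x E1]]] := second_difference t x (ltW h0) dt dtx.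
(* The same second difference, computed with the two variables exchanged. *)
have [y2 [s2 [y2x s2t E2]]] :=
  @second_difference (fun y s => F s y) (fun y s => Fx s y) (fun y s => Fxt s y)
    x t h (ltW h0) (fun y s => dx s y) (fun y s => dxt s y).
have E : Ftx s1 y1 = Fxt s2 y2.
  apply: (mulIf (lt0r_neq0 h0)); apply: (mulIf (lt0r_neq0 h0)).
  by rewrite -E1 -E2; ring.
have B1 : `|Ftx t x - Ftx s1 y1| < e / 2 by apply: H1; lra.
have B2 : `|Fxt t x - Fxt s2 y2| < e / 2 by apply: H2; lra.
move: B1 B2; rewrite E !ltr_norml ler_norml => /andP[? ?] /andP[? ?].
by apply/andP; split; lra.
Qed.

(** Proved coordinate by coordinate, since the mean value theorem behind [schwarz] is scalar. *)
Lemma partial_tx n (F : R -> R -> 'cV[R]_n) t x : smooth2 F ->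
  partial_t (partial_x F) t x = partial_x (partial_t F) t x.
Proof.
move=> Fs; have Ft := smooth2_partial_t Fs; have Fx := smooth2_partial_x Fs.
have Ftx := smooth2_partial_x Ft; have Fxt := smooth2_partial_t Fx.
apply/esym/colP => i.
have coord (H : R -> R -> 'cV[R]_n) : smooth2 H ->
    {for (t, x), continuous (fun p : R * R => H p.1 p.2 i 0)}.
  move=> Hs; apply: (@continuous_comp _ _ _ (fun p : R * R => H p.1 p.2)
    (fun M : 'cV[R]_n => M i 0)); first exact: smooth2_continuous.
  exact: coord_continuous.
apply: (@schwarz (fun s y => F s y i 0) (fun s y => partial_t F s y i 0)
  (fun s y => partial_x F s y i 0) (fun s y => partial_x (partial_t F) s y i 0)
  (fun s y => partial_t (partial_x F) s y i 0)).
- by move=> s y; have /is_derive_cV := is_derive_partial_t Fs s y; apply.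
- by move=> s y; have /is_derive_cV := is_derive_partial_x Fs s y; apply.
- by move=> s y; have /is_derive_cV := is_derive_partial_x Ft s y; apply.
- by move=> s y; have /is_derive_cV := is_derive_partial_t Fx s y; apply.
- exact: coord.
- exact: coord.
Qed.

End two_variables.

(** * First variation of the bending energy *)

Section bending_density.
Context {R : realType} {n : nat}.
Implicit Types u w : 'cV[R]_n.

(* rho |dT/ds|^2 ds = rho * density u w dx along a curve with first and second
   derivatives u and w. *)
Definition density u w : R :=
  (dot w w * dot u u - dot u w ^+ 2) * (enorm u)^-1 ^+ 5.

(** The differential of [density] at (u, w) in the direction (du, dw); the power 7 comes from
    differentiating |u|^-5. *)
Definition ddensity u w du dw : R :=
  (2 * dot w dw * dot u u + dot w w * (2 * dot u du)
   - 2 * dot u w * (dot du w + dot u dw)) * (enorm u)^-1 ^+ 5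
  - 5 * (dot w w * dot u u - dot u w ^+ 2) * dot u du * (enorm u)^-1 ^+ 7.

Lemma is_derive_enormV (u : R -> 'cV[R]_n) (x : R) du :
  is_derive x 1 u du -> u x != 0 ->
  is_derive x 1 (fun y => (enorm (u y))^-1) (- dot (u x) du * (enorm (u x))^-1 ^+ 3).
Proof.
move=> ud u0; have q0 : 0 < dot (u x) (u x) by rewrite lt_def dot_eq0 u0 dot_ge0.
have s0 : enorm (u x) != 0 by rewrite gt_eqF// enorm_gt0.
have dS := @is_derive1_comp _ Num.sqrt (fun y => dot (u y) (u y)) x _ _
  (is_derive1_sqrt q0) (is_derive_dot ud ud).
apply: (is_derive_eq (@is_deriveV _ (fun y => enorm (u y)) x _ 1 s0 dS)).
rewrite /GRing.scale/= -/(enorm (u x)) (dotC du).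
by field.
Qed.

(** With u = g' and w = g'', dT/ds = |u|^-2 w - <u, w> |u|^-4 u, whose squared length times |u| is
    the density. *)
Lemma bending_energy_density (a b : R) (rho : R -> R) (g : R -> 'cV[R]_n) :
  is_curve a b g ->
  bending_energy a b rho g =
  2^-1 * \int[@lebesgue_measure R]_(x in `[a, b]) (rho x * density (g^`() x) (g^`(2) x)).
Proof.
move=> [gs g0]; congr (_ * _); apply: eq_Rintegral => x; rewrite inE/= in_itv/= => xab.
have u0 := g0 _ xab.
have gd : is_derive x 1 g^`() (g^`()^`() x).
  by apply: smooth_is_derive; exact: smooth_derive1.
rewrite -mulrA; congr (_ * _).
rewrite {1 2}/dds (is_derive1E (is_deriveZv (is_derive_enormV gd u0) gd)).
rewrite /unit_tangent/dds; move: (g^`() x) u0 (g^`()^`() x) => u u0 w.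
rewrite /density dotZl dotZr dotDl !dotDr !dotZl !dotZr (dotC w u).
have s0 : enorm u != 0 by rewrite gt_eqF// enorm_gt0.
have -> : dot u u = enorm u ^+ 2 by rewrite sqr_sqrtr ?dot_ge0.
by field.
Qed.

Lemma is_derive_density (u w : R -> 'cV[R]_n) (t : R) du dw :
  is_derive t 1 u du -> is_derive t 1 w dw -> u t != 0 ->
  is_derive t 1 (fun s => density (u s) (w s)) (ddensity (u t) (w t) du dw).
Proof.
move=> ud wd u0.
have dp := is_derive_dot wd wd; have dq := is_derive_dot ud ud.
have dr := is_derive_dot ud wd; have ds := is_derive_enormV ud u0.
have dr2 := is_deriveX 2 dr; have ds5 := is_deriveX 5 ds.
apply: (is_derive_eq (is_deriveM (is_deriveB (is_deriveM dp dq) dr2) ds5)).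
rewrite /ddensity /GRing.scale/= !expr1 (dotC dw) (dotC du (u t)).
by rewrite !fctE; ring.
Qed.

(** * Continuity of the density and its differential, along an arbitrary filter so as to serve for x
    alone and for (t, x) *)

Section limits.
Variables (T : Type) (F : set_system T) (FF : Filter F).

Let cM (f h : T -> R) (x y : R) : f @ F --> x -> h @ F --> y ->
  (fun z => f z * h z) @ F --> x * y.
Proof. by move=> fx hy; exact: cvgM fx hy. Qed.

Let cB (f h : T -> R) (x y : R) : f @ F --> x -> h @ F --> y ->
  (fun z => f z - h z) @ F --> x - y.
Proof. by move=> fx hy; exact: cvgB fx hy. Qed.

Let cD (f h : T -> R) (x y : R) : f @ F --> x -> h @ F --> y ->
  (fun z => f z + h z) @ F --> x + y.
Proof. by move=> fx hy; exact: cvgD fx hy. Qed.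

Let cX (k : nat) (f : T -> R) (x : R) : f @ F --> x ->
  (fun z => f z ^+ k) @ F --> x ^+ k.
Proof.
by move=> fx; apply: (@cvg_comp _ _ _ f (fun z => z ^+ k) _ _ _ fx); exact: exprn_continuous.
Qed.

Let cC (c : R) : (fun _ : T => c) @ F --> c. Proof. exact: cvg_cst. Qed.

Let cdot := @cvg_dot R n T F FF.

Variables (u w du dw : T -> 'cV[R]_n) (p q dp dq : 'cV[R]_n).
Hypotheses (up : u @ F --> p) (wq : w @ F --> q) (p0 : p != 0).

Lemma cvg_enormV : (fun y => (enorm (u y))^-1) @ F --> (enorm p)^-1.
Proof.
apply: cvgV; first by rewrite gt_eqF// enorm_gt0.
apply: (@cvg_comp _ _ _ (fun y => dot (u y) (u y)) Num.sqrt _ _ _ (cdot up up)).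
exact: sqrt_continuous.
Qed.

Lemma cvg_density : (fun y => density (u y) (w y)) @ F --> density p q.
Proof.
have h := cB (cM (cdot wq wq) (cdot up up)) (cX (k := 2) (cdot up wq)).
exact: cM h (cX (k := 5) cvg_enormV).
Qed.

Lemma cvg_ddensity : du @ F --> dp -> dw @ F --> dq ->
  (fun y => ddensity (u y) (w y) (du y) (dw y)) @ F --> ddensity p q dp dq.
Proof.
move=> dup dwq.
have h1 := cM (cM (@cC 2) (cdot wq dwq)) (cdot up up).
have h2 := cM (cdot wq wq) (cM (@cC 2) (cdot up dup)).
have h3 := cM (cM (@cC 2) (cdot up wq)) (cD (cdot dup wq) (cdot up dwq)).
have h4 := cB (cM (cdot wq wq) (cdot up up)) (cX (k := 2) (cdot up wq)).
have h5 := cM (cB (cD h1 h2) h3) (cX (k := 5) cvg_enormV).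
exact: cB h5 (cM (cM (cM (@cC 5) h4) (cdot up dup)) (cX (k := 7) cvg_enormV)).
Qed.

End limits.
End bending_density.

(** * Differentiation under the integral sign and the first variation formula *)

Section first_variation.
Context {R : realType} {n : nat}.
Notation mu := (@lebesgue_measure R).

Lemma within_continuous_at (T U : topologicalType) (A : set T) (f : T -> U) :
  (forall x, A x -> {for x, continuous f}) -> {within A, continuous f}.
Proof.
move=> fc; apply: continuous_in_subspaceT => x; rewrite inE; exact: fc.
Qed.

Lemma compact_norm_bound (T : topologicalType) (A : set T) (f : T -> R) :
  compact A -> (forall x, A x -> {for x, continuous f}) ->
  exists2 M, 0 <= M & forall x, A x -> `|f x| <= M.
Proof.
move=> cA fc; have [M [_ HM]] : bounded_set (f @` A).
  by apply: compact_bounded; apply: continuous_compact cA; exact: within_continuous_at.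
(* Boundedness provides bounds strictly beyond [M] only, whence the added 1. *)
exists (`|M| + 1) => [|x Ax]; first by rewrite addr_ge0.
apply: (HM (`|M| + 1)); last by exists x.
by rewrite (le_lt_trans (ler_norm M))// ltrDl.
Qed.

Lemma is_derive_bending_energy (a b : R) (rho : R -> R) (e : R)
    (G : R -> R -> 'cV[R]_n) :
  let u := partial_x G in let w := partial_x u in
  continuous rho -> 0 < e -> smooth2 G ->
  (forall t, - e <= t <= e -> is_curve a b (G t)) ->
  is_derive (0 : R) 1 (fun t => bending_energy a b rho (G t))
    (2^-1 * \int[mu]_(x in `[a, b])
      (rho x * ddensity (u 0 x) (w 0 x) (partial_t u 0 x) (partial_t w 0 x))).
Proof.
move=> u w rc e0 Gs Gc.
have us : smooth2 u := smooth2_partial_x Gs.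
have ws : smooth2 w := smooth2_partial_x us.
have uts := smooth2_partial_t us; have wts := smooth2_partial_t ws.
pose E t x := rho x * density (u t x) (w t x).
pose D t x := rho x * ddensity (u t x) (w t x) (partial_t u t x) (partial_t w t x).
have u0 t x : - e <= t <= e -> a <= x <= b -> u t x != 0.
  by move=> te xab; exact: (Gc t te).2.
have slice (F : R -> R -> 'cV[R]_n) t x : smooth2 F -> F t y @[y --> x] --> F t x.
  move=> Fs. exact: (smooth_continuous (@smooth2_smooth _ _ _ Fs t)).
have Ec t x : - e <= t <= e -> a <= x <= b -> {for x, continuous (E t)}.
  move=> te xab; apply: cvgM; first exact: rc.
  by apply: cvg_density; [exact: slice|exact: slice|exact: u0].
have Dc t x : - e <= t <= e -> a <= x <= b ->
    {for (t, x), continuous (fun p : R * R => D p.1 p.2)}.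
  move=> te xab; apply: cvgM.
    by apply: (@cvg_comp _ _ _ snd rho); [exact: cvg_snd|exact: rc].
  apply: cvg_ddensity; try exact: smooth2_continuous.
  exact: u0.
have dE t x : - e <= t <= e -> a <= x <= b ->
    is_derive t 1 (fun s => E s x) (D t x).
  move=> te xab.
  have d := is_derive_density (is_derive_partial_t us t x)
    (is_derive_partial_t ws t x) (u0 t x te xab).
  apply: (is_derive_eq (is_deriveM (is_derive_cst (rho x) t 1) d)).
  by rewrite scaler0 addr0.
(* Compactness of [-e, e] x [a, b] gives a constant dominating the t-derivative of the integrand, as
   differentiation under the integral requires. *)
have [M M0 DM] : exists2 M, 0 <= M & forall p : R * R,
    (`[- e, e] `*` `[a, b])%classic p -> `|D p.1 p.2| <= M.
  apply: compact_norm_bound; first by apply: compact_setX; exact: segment_compact.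
  by move=> [t x] [/=]; rewrite !in_itv/=; exact: Dc.
have oc t : [set` `]- e, e[] t -> - e <= t <= e.
  by rewrite /= in_itv/= => /andP[h1 h2]; rewrite !ltW.
have I0 : [set` `]- e, e[] 0 by rewrite /= in_itv/= oppr_lt0 e0.
have intE t : [set` `]- e, e[] t -> mu.-integrable `[a, b] (EFin \o E t).
  move=> /oc te; apply: continuous_integrable_itv; apply: within_continuous_at => x.
  by rewrite /= in_itv/=; exact: Ec.
have derE t x : [set` `]- e, e[] t -> [set` `[a, b]] x ->
    derivable (fun s => E s x) t 1.
  by move=> /oc te; rewrite /= in_itv/= => xab; case: (dE t x te xab).
have intM : mu.-integrable `[a, b] (EFin \o (fun=> M)).
  by apply: continuous_integrable_itv; apply: continuous_subspaceT; exact: cst_continuous.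
have boundE t x : [set` `]- e, e[] t -> [set` `[a, b]] x ->
    `|partial1of2 E t x| <= M.
  move=> /oc te; rewrite /= in_itv/= => xab.
  rewrite /partial1of2 (is_derive1E (dE t x te xab)).
  by apply: (DM (t, x)); split; rewrite /= in_itv.
have mI := @measurable_itv R `[a, b].
have dI := @derivable_under_integral R _ _ mu E _ mI _ _ _ I0 intE derE _ (fun=> M0) intM boundE.
have eI := @differentiation_under_integral R _ _ mu E _ mI _ _ _ I0 intE derE _ (fun=> M0) intM boundE.
have isI : is_derive (0 : R) 1 (fun t => \int[mu]_(x in `[a, b]) E t x)
    (\int[mu]_(x in `[a, b]) D 0 x).
  have -> : \int[mu]_(x in `[a, b]) D 0 x = \int[mu]_(x in `[a, b]) partial1of2 E 0 x.
    apply: eq_Rintegral => x; rewrite inE/= in_itv/= => xab.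
    by rewrite /partial1of2 (is_derive1E (dE 0 x (oc _ I0) xab)).
  by rewrite -eI; exact: is_derive1P.
have h : is_derive (0 : R) 1 (fun t => 2^-1 * \int[mu]_(x in `[a, b]) E t x)
    (2^-1 * \int[mu]_(x in `[a, b]) D 0 x).
  exact: (is_deriveZ 2^-1 isI).
(* The density formula holds for the energy as long as [G t] is a curve, hence for t near 0, which
   is enough for a derivative at 0. *)
apply: near_eq_is_derive h; near=> t.
rewrite (@bending_energy_density _ _ a b rho (G t))//.
by apply: Gc; apply: oc; near: t; exact: near_in_itvoo.
Unshelve. all: by end_near. Qed.

(** At t = 0 one has |u| = 1 and <u, w> = <u, du> = 0, so the differential of the density collapses
    to 2 <w, dw> with w = T' and dw = V''; the 2 cancels the factor 1/2 of the energy. *)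
Lemma first_variation (a b : R) (rho : R -> R) (g : R -> 'cV[R]_n) (e : R)
    (G : R -> R -> 'cV[R]_n) (V : R -> 'cV[R]_n) : a < b ->
  arclength_parametrized a b g -> smooth rho -> is_variation a b g e G ->
  smooth V -> (forall x, a <= x <= b -> dot (V^`() x) (g^`() x) = 0) ->
  (forall x, a <= x <= b -> variational_field G x = V x) ->
  is_derive (0 : R) 1 (fun t => bending_energy a b rho (G t))
    (\int[mu]_(x in `[a, b]) (rho x * dot (g^`(2) x) (V^`(2) x))).
Proof.
move=> ab [[gs g0] g1] rs [e0 Gs Gg Gc] Vs Vg GV.
apply: (is_derive_eq (is_derive_bending_energy (smooth_continuous rs) e0 Gs Gc)).
have G0s := @smooth2_smooth _ _ _ Gs 0.
have us := smooth2_partial_x Gs.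
have Gts := smooth2_partial_t Gs.
have G0t := @smooth2_smooth _ _ _ Gts 0.
have gs' := smooth_derive1 gs; have Vs' := smooth_derive1 Vs.
have uE x : a <= x <= b -> partial_x G 0 x = g^`() x.
  exact: (derive1_eq_itv_cV ab G0s gs Gg).
have wE x : a <= x <= b -> partial_x (partial_x G) 0 x = g^`()^`() x.
  exact: (derive1_eq_itv_cV ab (smooth_derive1 G0s) gs' uE).
have tE x : a <= x <= b -> partial_x (partial_t G) 0 x = V^`() x.
  exact: (derive1_eq_itv_cV ab G0t Vs GV).
have utE x : partial_t (partial_x G) 0 x = partial_x (partial_t G) 0 x.
  exact: partial_tx.
(* The t-derivative is moved inside both x-derivatives, one exchange at a time. *)
have wtE x : a <= x <= b -> partial_t (partial_x (partial_x G)) 0 x = V^`()^`() x.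
  move=> xab; rewrite (@partial_tx _ _ _ 0 x us).
  change ((partial_t (partial_x G) 0)^`() x = V^`()^`() x).
  have -> : partial_t (partial_x G) 0 = partial_x (partial_t G) 0.
    by apply/funext => y; exact: utE.
  exact: (derive1_eq_itv_cV ab (smooth_derive1 G0t) Vs' tE).
have g11 x : a <= x <= b -> dot (g^`() x) (g^`() x) = 1.
  by move=> xab; apply: enorm_eq1; exact: g1.
have g12 x : a <= x <= b -> dot (g^`() x) (g^`()^`() x) = 0.
  move=> xab.
  have := derive1_eq_itv ab (smooth_dot gs' gs') (@smooth_cst _ _ (1 : R)) g11 xab.
  have gd := smooth_is_derive x gs'.
  rewrite (is_derive1E (is_derive_dot gd gd)) (is_derive1E (is_derive_cst _ _ _)).
  by rewrite dotC => h; lra.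
rewrite -RintegralZl//; last first.
  apply: continuous_integrable_itv; apply: within_continuous_at => x.
  rewrite /= in_itv/= => xab; apply: cvgM; first exact: smooth_continuous.
  have c (F : R -> R -> 'cV[R]_n) : smooth2 F -> F 0 y @[y --> x] --> F 0 x.
    by move=> Fs; exact: (smooth_continuous (@smooth2_smooth _ _ _ Fs 0)).
  have ws := smooth2_partial_x us.
  apply: cvg_ddensity.
  - exact: (c _ us).
  - exact: (c _ ws).
  - by rewrite (uE _ xab); exact: g0.
  - exact: (c _ (smooth2_partial_t us)).
  - exact: (c _ (smooth2_partial_t ws)).
apply: eq_Rintegral => x; rewrite inE/= in_itv/= => xab.
rewrite (uE _ xab) (wE _ xab) (wtE _ xab) utE (tE _ xab) /ddensity.
move: (g11 _ xab) (g12 _ xab) (Vg _ xab) (g1 _ xab).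
move: (g^`() x) (g^`()^`() x) (V^`() x) (V^`()^`() x) => u w v z.
move=> u1 uw vu eu; rewrite u1 uw (dotC u) vu eu invr1 !expr1n.
by field.
Qed.

End first_variation.

(** * Pointwise multipliers *)

Section pointwise.
Context {R : realType} {n : nat}.
Implicit Types t v : 'cV[R]_n.

(** Here t, t1, t2 stand for T, T', T'', and the hypotheses are |T|^2 = 1 with its first two
    derivatives. The normal part of the vector equation is the elastic equation, the tangential part
    determines [l]. *)
Lemma elastic_equation_pointwise t t1 t2 v (r r1 l : R) :
  dot t t = 1 -> dot t t1 = 0 -> dot t t2 = - dot t1 t1 ->
  (r *: t2 + r1 *: t1 + (3 / 2 * r * dot t1 t1 - l) *: t = v) <->
  (r *: t2 + r1 *: t1 - (r * dot t2 t) *: t = v - dot v t *: t /\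
   l = 2^-1 * r * dot t1 t1 - dot v t).
Proof.
move=> tt tt1 tt2; rewrite (dotC t2) tt2.
split=> [ve|[ve ->]].
  have vt : dot v t = - r * dot t1 t1 + (3 / 2 * r * dot t1 t1 - l).
    by rewrite -ve 2!dotDl 3!dotZl !(dotC _ t) tt tt1 tt2; ring.
  split; last by rewrite vt; field.
  rewrite vt -ve; apply/colP => i; rewrite !mxE; ring.
rewrite -[RHS](subrK (dot v t *: t)) -ve; move: (dot v t) => c; apply/colP => i; rewrite !mxE; by field.
Qed.

(** Tangential component of the Euler-Lagrange expression: the terms in [r] cancel, and those in
    [r1] combine as -2 + 3/2 = -1/2. *)
Lemma EL_dot_tangent t t1 t2 t3 (r r1 r2 l l1 : R) :
  dot t t = 1 -> dot t t1 = 0 -> dot t t2 = - dot t1 t1 ->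
  dot t t3 = - 3 * dot t1 t2 ->
  dot (r *: t3 + (3 * r * dot t1 t2) *: t + (3 / 2 * r * dot t1 t1) *: t1
    + r2 *: t1 + (2 * r1) *: t2 + (3 / 2 * r1 * dot t1 t1) *: t - l1 *: t - l *: t1) t =
  - (2^-1 * r1 * dot t1 t1) - l1.
Proof.
move=> tt tt1 tt2 tt3; rewrite 7!dotDl 2!dotNl 8!dotZl !(dotC _ t) tt tt1 tt2 tt3.
by field.
Qed.

Lemma normal_part_dot t v : dot t t = 1 ->
  dot (v - dot v t *: t) t = 0 /\
  dot v (v - dot v t *: t) = dot (v - dot v t *: t) (v - dot v t *: t).
Proof.
move=> tt; have vt : dot (v - dot v t *: t) t = 0.
  by rewrite dotDl dotNl dotZl tt mulr1 subrr.
split=> //.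
move: vt; set p := v - dot v t *: t => vt.
have vE : v = p + dot v t *: t by rewrite subrK.
by rewrite {1}vE dotDl dotZl (dotC t) vt mulr0 addr0.
Qed.

End pointwise.

(** * First integral of the Euler-Lagrange equation and the multiplier *)

Section multipliers.
Context {R : realType} {n : nat}.
Variables (a b : R) (rho : R -> R) (T : R -> 'cV[R]_n).
Hypotheses (ab : a < b) (rs : smooth rho) (Ts : smooth T).
Hypothesis T1 : forall x, a <= x <= b -> dot (T x) (T x) = 1.

Let Ts1 : smooth T^`() := smooth_derive1 Ts.
Let Ts2 : smooth T^`(2) := smooth_derive1 Ts1.

Let D0 x := smooth_is_derive x Ts.
Let D1 (x : R) : is_derive x 1 T^`() (T^`(2) x) := smooth_is_derive x Ts1.
Let D2 (x : R) : is_derive x 1 T^`(2) (T^`(3) x) := smooth_is_derive x Ts2.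

Lemma dot_tangent_derive1 x : a <= x <= b -> dot (T x) (T^`() x) = 0.
Proof.
move=> xab; have := derive1_eq_itv ab (smooth_dot Ts Ts) (@smooth_cst _ _ (1 : R)) T1 xab.
rewrite (is_derive1E (is_derive_dot (D0 x) (D0 x))) derive1_cst.
by rewrite (dotC (T^`() x)); move: (dot _ _) => c h; lra.
Qed.

Lemma dot_tangent_derive2 x : a <= x <= b ->
  dot (T x) (T^`(2) x) = - dot (T^`() x) (T^`() x).
Proof.
move=> xab; have := derive1_eq_itv ab (smooth_dot Ts Ts1) (@smooth_cst _ _ (0 : R))
  dot_tangent_derive1 xab.
rewrite (is_derive1E (is_derive_dot (D0 x) (D1 x))) derive1_cst.
by rewrite addrC => /eqP; rewrite addr_eq0 => /eqP.
Qed.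

Lemma dot_tangent_derive3 x : a <= x <= b ->
  dot (T x) (T^`(3) x) = - 3 * dot (T^`() x) (T^`(2) x).
Proof.
move=> xab.
(* This function vanishes on [a, b]; differentiating it gives <T, T'''> + 3 <T', T''> = 0. *)
have smt : smooth (fun y => dot (T y) (T^`(2) y) + dot (T^`() y) (T^`() y)).
  by apply: smoothD; exact: smooth_dot.
have := derive1_eq_itv ab smt (@smooth_cst _ _ (0 : R)) _ xab.
have d := is_deriveD (is_derive_dot (D0 x) (D2 x)) (is_derive_dot (D1 x) (D1 x)).
rewrite (is_derive1E d) derive1_cst => /(_ _)/wrap[|].
  by move=> y yab; rewrite dot_tangent_derive2// addNr.
move: (T x) (T^`() x) (T^`(2) x) (T^`(3) x) => t t1 t2 t3.
by rewrite (dotC t2); lra.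
Qed.

Definition EL_primitive (L : R -> R) (x : R) : 'cV[R]_n :=
  rho x *: T^`(2) x + rho^`() x *: T^`() x +
  (3 / 2 * rho x * dot (T^`() x) (T^`() x) - L x) *: T x.

Let coef_smooth L : smooth L ->
  smooth (fun x => 3 / 2 * rho x * dot (T^`() x) (T^`() x) - L x).
Proof.
move=> Ls; have -> : (fun x => 3 / 2 * rho x * dot (T^`() x) (T^`() x) - L x) =
    (fun x => 3 / 2 * (rho x * dot (T^`() x) (T^`() x)) + (- 1) * L x).
  by apply/funext => x; rewrite mulN1r mulrA.
have h1 := smoothM (@smooth_cst _ _ (3 / 2 : R)) (smoothM rs (smooth_dot Ts1 Ts1)).
exact: (smoothD h1 (smoothM (@smooth_cst _ _ (- 1 : R)) Ls)).
Qed.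

Lemma smooth_EL_primitive L : smooth L -> smooth (EL_primitive L).
Proof.
move=> Ls; have h := smoothD (smoothZ rs Ts2) (smoothZ (smooth_derive1 rs) Ts1).
exact: (smoothD h (smoothZ (coef_smooth Ls) Ts)).
Qed.

Lemma derive1_EL_primitive L x : smooth L -> (EL_primitive L)^`() x = EL rho T L x.
Proof.
move=> Ls; apply: is_derive1E.
have dr := smooth_is_derive x rs; have dr1 := smooth_is_derive x (smooth_derive1 rs).
have dL := smooth_is_derive x Ls.
have dc : is_derive x 1 (fun x => 3 / 2 * rho x * dot (T^`() x) (T^`() x) - L x)
    (3 / 2 * rho^`() x * dot (T^`() x) (T^`() x) +
     3 * rho x * dot (T^`() x) (T^`(2) x) - L^`() x).
  have d1 := is_deriveZ (3 / 2) (is_deriveM dr (is_derive_dot (D1 x) (D1 x))).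
  have d2 := is_deriveB d1 dL.
  have -> : (fun x => 3 / 2 * rho x * dot (T^`() x) (T^`() x) - L x) =
      (3 / 2 *: (rho * (fun x => dot (T^`() x) (T^`() x))) - L).
    by apply/funext => y; rewrite !fctE /GRing.scale/= mulrA.
  apply: (is_derive_eq d2).
  rewrite (dotC (T^`(2) x)) /GRing.scale/=.
  by move: (dot (T^`() x) (T^`()^`() x)) (dot (T^`() x) (T^`() x)) => p q; field.
have d := is_deriveD (is_deriveD (is_deriveZv dr (D2 x)) (is_deriveZv dr1 (D1 x)))
  (is_deriveZv dc (D0 x)).
apply: (is_derive_eq d); rewrite /EL.
rewrite -[rho^`()^`() x]/(rho^`(2) x).
move: (T x) (T^`() x) (T^`(2) x) (T^`(3) x) => t t1 t2 t3.
move: (dot t1 t2) (dot t1 t1) => p q.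
apply/colP => i; rewrite !mxE; by field.
Qed.

Lemma EL_eq0P (L : R -> R) : smooth L ->
  (forall x, a <= x <= b -> EL rho T L x = 0) <->
  exists v, elastic_equation a b rho T v /\
    (forall x, a <= x <= b ->
      L x = 2^-1 * rho x * dot (T^`() x) (T^`() x) - dot v (T x)).
Proof.
move=> Ls.
have pw v x : a <= x <= b -> _ := fun xab => elastic_equation_pointwise v (rho x)
  (rho^`() x) (L x) (T1 xab) (dot_tangent_derive1 xab) (dot_tangent_derive2 xab).
split=> [EL0|[v [ve Lv]] x xab].
  (* The first integral has zero derivative on [a, b], so its value at [a] is the constant vector
     sought. *)
  exists (EL_primitive L a).
  have H x : a <= x <= b -> EL_primitive L x = EL_primitive L a.
    apply: (derive1_0_cst_itv_cV (smooth_EL_primitive Ls)) => y yab.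
    by rewrite derive1_EL_primitive// EL0.
  by split=> x xab; case: ((pw _ _ xab).1 (H x xab)).
rewrite -derive1_EL_primitive//.
have H y : a <= y <= b -> EL_primitive L y = v.
  by move=> yab; apply: (pw _ _ yab).2; split; [exact: ve|exact: Lv].
by rewrite (derive1_eq_itv_cV ab (smooth_EL_primitive Ls) (@smooth_cst _ _ v) H xab) derive1_cst.
Qed.

(** Tangential component of the Euler-Lagrange equation. It shows that the multiplier is constant as
    soon as the stiffness is. *)
Lemma multiplier_derive1 (L : R -> R) x : a <= x <= b -> EL rho T L x = 0 ->
  L^`() x = - (2^-1 * rho^`() x * dot (T^`() x) (T^`() x)).
Proof.
move=> xab EL0.
have := EL_dot_tangent (rho x) (rho^`() x) (rho^`(2) x) (L x) (L^`() x) (T1 xab)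
  (dot_tangent_derive1 xab) (dot_tangent_derive2 xab) (dot_tangent_derive3 xab).
rewrite -/(EL rho T L x) EL0 dot0l.
by move=> /esym/eqP; rewrite subr_eq0 => /eqP.
Qed.

Lemma multiplier_cst (L : R -> R) c : smooth L ->
  (forall x, a <= x <= b -> rho x = c) ->
  (forall x, a <= x <= b -> EL rho T L x = 0) ->
  forall x, a <= x <= b -> L x = L a.
Proof.
move=> Ls rc EL0; apply: (derive1_0_cst_itv Ls) => x xab.
rewrite (multiplier_derive1 xab (EL0 _ xab)).
rewrite (derive1_eq_itv ab rs (@smooth_cst _ _ c) rc xab) derive1_cst.
by rewrite mulr0 mul0r oppr0.
Qed.

End multipliers.

Lemma dot_curvature (R : realType) (m : nat) (a b : R) (g : R -> 'cV[R]_m.+1)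
    (kappa : R -> 'cV[R]_m) : arclength_parametrized a b g ->
  is_curvature_function a b g kappa ->
  forall x, a <= x <= b -> dot (g^`(2) x) (g^`(2) x) = dot (kappa x) (kappa x).
Proof.
move=> [_ g1] [_ [N [[Npar Ndet] NE]]] x xab.
rewrite NE// dotNl dotNr opprK.
have NN : (N x)^T *m N x = 1%:M.
  pose A : 'M[R]_(1 + m) := row_mx (g^`() x) (N x).
  have A1 : A^T *m A = 1%:M.
    apply: unit_columns_orthonormal; last exact: Ndet.
    move=> j; case: (split_ordP j) => k ->.
      rewrite colKl (_ : col k (g^`() x) = g^`() x).
        by apply: enorm_eq1; exact: g1.
      by apply/colP => i; rewrite mxE ord1.
    rewrite colKr; apply: enorm_eq1.
    by have [_ /(_ x xab)[_ ->]] := Npar k.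
  (* The lower right block of A^T A = 1 says that the normal fields are orthonormal, so that [N x]
     preserves lengths. *)
  move: A1; rewrite /A tr_mul_row scalar_mx_block => /eq_block_mx[_ _ _].
  exact.
have : (dot (N x *m kappa x) (N x *m kappa x))%:M =
    (dot (kappa x) (kappa x))%:M :> 'M[R]_1.
  by rewrite -!dot_mx trmx_mul -mulmxA (mulmxA _ (N x)) NN mul1mx.
by move=> /matrixP/(_ 0 0); rewrite [LHS]mxE [RHS]mxE !mulr1n.
Qed.

(** * Elastic curves *)

Section elastic.
Context {R : realType} {n : nat}.
Notation mu := (@lebesgue_measure R).

(** An endpoint lies outside the closure of the nonvanishing set, so [V] is zero on a small interval
    of [a, b] ending there; this determines the derivative at the endpoint too. *)
Lemma compact_support_boundary (a b : R) (V : R -> 'cV[R]_n) : a < b ->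
  smooth_compact_support a b V ->
  (V a = 0 /\ V^`() a = 0) /\ (V b = 0 /\ V^`() b = 0).
Proof.
move=> ab [Vs Vsupp].
have zero x : a <= x <= b -> ~ (a < x < b) ->
    V x = 0 /\ \forall y \near x, a <= y <= b -> V y = 0.
  move=> xab xN.
  have V0 : \forall y \near x, a <= y <= b -> V y = 0.
    apply: contrapT => H; apply: xN.
    have : closure [set x | a <= x <= b /\ V x != 0] x.
      move=> B Bx; apply: contrapT => BN; apply: H.
      apply: filterS Bx => y By yab; apply: contrapT => /eqP Vy.
      by apply: BN; exists y.
    by move=> /Vsupp; rewrite /= in_itv.
  by split=> //; exact: (nbhs_singleton V0).
have cst0 := @smooth_cst R _ (0 : 'cV[R]_n).
split.
  have aab : a <= a <= b by rewrite lexx ltW.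
  have [Va /nbhs_ballP[d /= d0 Hd]] := zero a aab ltac:(by rewrite ltxx).
  split=> //.
  pose c := Num.min b (a + d / 2).
  have ac : a < c by rewrite lt_min ab ltrDl divr_gt0.
  have V0 y : a <= y <= c -> V y = 0.
    rewrite le_min => /and3P[ay yb yd]; apply: Hd; last by rewrite ay.
    by rewrite /ball/= ltr_distlC; lra.
  rewrite (derive1_eq_itv_cV ac Vs cst0 V0) ?derive1_cst//.
  by rewrite lexx ltW.
have bab : a <= b <= b by rewrite lexx ltW.
have [Vb /nbhs_ballP[d /= d0 Hd]] := zero b bab ltac:(by rewrite ltxx andbF).
split=> //.
pose c := Num.max a (b - d / 2).
have cb : c < b by rewrite gt_max ab ltrBlDr ltrDl divr_gt0.
have V0 y : c <= y <= b -> V y = 0.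
  rewrite ge_max -andbA => /and3P[ay yd yb]; apply: Hd; last by rewrite ay.
  by rewrite /ball/= ltr_distlC; lra.
rewrite (derive1_eq_itv_cV cb Vs cst0 V0) ?derive1_cst//.
by rewrite lexx ltW.
Qed.

Lemma elastic_equation_elastic (a b : R) (rho : R -> R) (g : R -> 'cV[R]_n)
    (v : 'cV[R]_n) : a < b -> smooth rho -> arclength_parametrized a b g ->
  elastic_equation a b rho g^`() v -> is_elastic a b rho g.
Proof.
move=> ab rs hg ve; split=> // V Vsupp Vg e G Gvar GV.
have [Vs _] := Vsupp.
apply: (is_derive_eq (first_variation ab hg rs Gvar Vs Vg GV)).
have gs := hg.1.1.
have Ts := smooth_derive1 gs; have Ts1 := smooth_derive1 Ts.
have Vs1 := smooth_derive1 Vs.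
(* F' = rho <T', V''> + <(rho T')' - v, V'>, and the last term vanishes because (rho T')' - v is
   tangential while V' is normal. *)
pose F x := rho x * dot (g^`()^`() x) (V^`() x) - dot v (V x).
have dF (x : R) : is_derive x 1 F (rho x * dot (g^`()^`() x) (V^`()^`() x) +
    dot (rho x *: g^`()^`()^`() x + rho^`() x *: g^`()^`() x - v) (V^`() x)).
  have dT1 := smooth_is_derive x Ts1; have dV1 := smooth_is_derive x Vs1.
  have dV := smooth_is_derive x Vs; have dr := smooth_is_derive x rs.
  have dd := is_deriveB (is_deriveM dr (is_derive_dot dT1 dV1))
    (is_derive_dot (is_derive_cst v x 1) dV).
  apply: (is_derive_eq dd); rewrite dot0l add0r /GRing.scale/=.
  move: (g^`()^`() x) (g^`()^`()^`() x) (V^`()^`() x) (V^`() x) => t1 t2 v2 v1.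
  by rewrite 2!dotDl dotNl 2!dotZl; ring.
have Fs : smooth F.
  have -> : F = fun x => rho x * dot (g^`()^`() x) (V^`() x) + (- 1) * dot v (V x).
    by apply/funext => x; rewrite mulN1r.
  have h1 := smoothM rs (smooth_dot Ts1 Vs1).
  exact: (smoothD h1 (smoothM (@smooth_cst _ _ (- 1 : R)) (smooth_dot (@smooth_cst _ _ v) Vs))).
have IF := Rintegral_derive ab (smooth_continuous (smooth_derive1 Fs))
  (fun x => smooth_is_derive x Fs).
have [[Va V1a] [Vb V1b]] := compact_support_boundary ab Vsupp.
have -> : \int[mu]_(x in `[a, b]) (rho x * dot (g^`(2) x) (V^`(2) x)) =
    \int[mu]_(x in `[a, b]) F^`() x.
  apply: eq_Rintegral => x; rewrite inE/= in_itv/= => xab.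
  rewrite (is_derive1E (dF x)) -[LHS]addr0; congr (_ + _).
  have := ve x xab; have := Vg x xab.
  rewrite -[g^`()^`(2) x]/(g^`()^`()^`() x).
  move: (g^`() x) (g^`()^`() x) (g^`()^`()^`() x) (V^`() x) => t t1 t2 v1 v1t tE.
  have -> : rho x *: t2 + rho^`() x *: t1 - v = (rho x * dot t2 t - dot v t) *: t.
    move: tE => /eqP; rewrite subr_eq => /eqP ->.
    by apply/colP => i; rewrite !mxE; ring.
  by rewrite dotZl (dotC t) v1t mulr0.
have Fz x : V x = 0 -> V^`() x = 0 -> F x = 0.
  move=> Vx V1x.
  apply: (etrans (congr2 (fun w z => rho x * dot (g^`()^`() x) w - dot v z) V1x Vx)).
  by rewrite !dot0r mulr0 subrr.
by rewrite IF (Fz a)// (Fz b)// subrr.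
Qed.

Lemma RintegralZD (a b c : R) (f h : R -> R) : continuous f -> continuous h ->
  \int[mu]_(x in `[a, b]) (c * f x + h x) =
  c * \int[mu]_(x in `[a, b]) f x + \int[mu]_(x in `[a, b]) h x.
Proof.
move=> fc hc.
have ic (k : R -> R) : continuous k -> mu.-integrable `[a, b] (EFin \o k).
  by move=> kc; apply: continuous_integrable_itv; exact: continuous_subspaceT.
have cfc : continuous (fun x => c * f x).
  by move=> x; apply: cvgM; [exact: cvg_cst|exact: fc].
rewrite RintegralD//; [|exact: ic..].
by rewrite RintegralZl//; exact: ic.
Qed.

(** Continuity of the sum is carried along with the formula because each induction step needs it to
    split the integral. *)
Lemma Rintegral_lin_comb (k : nat) (a b : R) (v : 'I_k -> R) (f : 'I_k -> R -> R) :
  (forall i, continuous (f i)) ->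
  continuous (fun x => \sum_i v i * f i x) /\
  \int[mu]_(x in `[a, b]) (\sum_i v i * f i x) =
  \sum_i v i * \int[mu]_(x in `[a, b]) f i x.
Proof.
elim: k v f => [|k IH] v f fc.
  have -> : (fun x => \sum_(i < 0) v i * f i x) = fun=> 0.
    by apply/funext => x; rewrite big_ord0.
  split; first exact: cst_continuous.
  by rewrite big_ord0 /Rintegral integral0.
have [c IHe] := IH (fun i => v (lift ord0 i)) (fun i => f (lift ord0 i))
  (fun i => fc (lift ord0 i)).
have -> : (fun x => \sum_i v i * f i x) =
    fun x => v ord0 * f ord0 x + \sum_i v (lift ord0 i) * f (lift ord0 i) x.
  by apply/funext => x; rewrite big_ord_recl.
split.
  move=> x; apply: cvgD (c x); apply: cvgM; [exact: cvg_cst|exact: (fc ord0)].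
by rewrite (RintegralZD _ _ _ (fc ord0) c) IHe big_ord_recl.
Qed.

Lemma smooth_primitive (V : normedModType R) (f df : R -> V) :
  (forall x : R, is_derive x 1 f (df x)) -> smooth df -> smooth f.
Proof.
move=> fd /smoothP dfs; apply/smoothP => -[|k].
  by split=> [x|//]; case: (fd x).
split=> [x|]; first by case: (fd x).
have -> : f^`() = df by apply/funext => x; exact: is_derive1E.
exact: dfs.
Qed.

(** The form A + t B is stable: the partial derivatives correspond to the pairs (B, 0) and (A', B'),
    so induction on the order closes. *)
Lemma smooth2_affine (A B : R -> 'cV[R]_n) : smooth A -> smooth B ->
  smooth2 (fun t x => A x + t *: B x).
Proof.
have cont (C D : R -> 'cV[R]_n) : smooth C -> smooth D ->
    continuous (fun p : R * R => C p.2 + p.1 *: D p.2).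
  move=> Cs Ds [t x]; apply: cvgD.
    by apply: (@cvg_comp _ _ _ snd C); [exact: cvg_snd|exact: (smooth_continuous Cs)].
  apply: cvgZ; first exact: cvg_fst.
  by apply: (@cvg_comp _ _ _ snd D); [exact: cvg_snd|exact: (smooth_continuous Ds)].
move=> As Bs k; elim: k A B As Bs => [|k IH] A B As Bs.
  by split; first exact: cont.
have dt (t x : R) : is_derive t 1 (fun s => A x + s *: B x) (B x).
  have d := is_deriveD (is_derive_cst (A x) t 1)
    (is_deriveZv (is_derive_id t 1) (is_derive_cst (B x) t 1)).
  by apply: (is_derive_eq d); rewrite add0r scale1r scaler0 addr0.
have dx (t x : R) : is_derive x 1 (fun y => A y + t *: B y) (A^`() x + t *: B^`() x).
  exact: (is_deriveD (smooth_is_derive x As) (is_deriveZ t (smooth_is_derive x Bs))).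
split; first exact: cont.
split.
- by move=> t x; case: (dt t x).
- by move=> t x; case: (dx t x).
- have -> : (fun t x => (fun s => A x + s *: B x)^`() t) = fun t x => B x + t *: 0.
    by apply/funext => t; apply/funext => x; rewrite (is_derive1E (dt t x)) scaler0 addr0.
  exact: (IH _ _ Bs (@smooth_cst _ _ 0)).
- have -> : (fun t x => (fun y => A y + t *: B y)^`() x) =
      fun t x => A^`() x + t *: B^`() x.
    by apply/funext => t; apply/funext => x; rewrite (is_derive1E (dx t x)).
  exact: (IH _ _ (smooth_derive1 As) (smooth_derive1 Bs)).
Qed.

(** Since V' is orthogonal to g', |g' + t V'|^2 = 1 + t^2 |V'|^2 > 0 for every t; the range e = 1 is
    arbitrary. *)
Lemma is_variation_affine (a b : R) (g V : R -> 'cV[R]_n) :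
  arclength_parametrized a b g -> smooth V ->
  (forall x, a <= x <= b -> dot (V^`() x) (g^`() x) = 0) ->
  is_variation a b g 1 (fun t x => g x + t *: V x).
Proof.
move=> [[gs g0] g1] Vs Vg; have Gs := smooth2_affine gs Vs.
split; [exact: ltr01|exact: Gs|by move=> x _; rewrite scale0r addr0|].
move=> t _; split; first exact: (@smooth2_smooth _ _ _ Gs t).
move=> x xab.
have d := is_deriveD (smooth_is_derive x gs) (is_deriveZ t (smooth_is_derive x Vs)).
rewrite (is_derive1E d).
have := enorm_eq1 (g1 x xab); have := Vg x xab.
move: (g^`() x) (V^`() x) => u w wu uu.
rewrite -dot_eq0 gt_eqF// dotDl 2!dotDr 2!dotZl 2!dotZr (dotC u) wu uu !mulr0 addr0 add0r.
by rewrite ltr_wpDr// mulrA mulr_ge0 ?dot_ge0// -expr2 sqr_ge0.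
Qed.

(** Along the straight variation g + t V the derivative of the energy at 0 is 0 by criticality and
    the integral by the first variation formula. *)
Lemma elastic_critical (a b : R) (rho : R -> R) (g V : R -> 'cV[R]_n) : a < b ->
  smooth rho -> is_elastic a b rho g -> smooth_compact_support a b V ->
  (forall x, a <= x <= b -> dot (V^`() x) (g^`() x) = 0) ->
  \int[mu]_(x in `[a, b]) (rho x * dot (g^`(2) x) (V^`(2) x)) = 0.
Proof.
move=> ab rs [hg crit] Vsupp Vg; have Vs := Vsupp.1.
pose G t x := g x + t *: V x.
have Gvar : is_variation a b g 1 G := is_variation_affine hg Vs Vg.
have GV x : a <= x <= b -> variational_field G x = V x.
  move=> _; rewrite /variational_field /G.
  have d := is_deriveD (is_derive_cst (g x) (0 : R) 1)
    (is_deriveZv (is_derive_id (0 : R) 1) (is_derive_cst (V x) (0 : R) 1)).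
  by rewrite (is_derive1E d) add0r scale1r scaler0 addr0.
have d0 := crit V Vsupp Vg 1 G Gvar GV.
have d1 := first_variation ab hg rs Gvar Vs Vg GV.
by rewrite -(is_derive1E d1) (is_derive1E d0).
Qed.

(* The derivatives of the admissible variations are the fields of this class with
   vanishing integral. *)
Definition tangential_test (a b : R) (g W : R -> 'cV[R]_n) : Prop :=
  [/\ smooth W,
    exists c d, [/\ a < c, c < d, d < b & forall x, ~~ (c < x < d) -> W x = 0]
  & forall x, a <= x <= b -> dot (W x) (g^`() x) = 0].

Lemma tangential_test_linear (a b : R) (g : R -> 'cV[R]_n) k (W Z : R -> 'cV[R]_n) :
  tangential_test a b g W -> tangential_test a b g Z ->
  tangential_test a b g (k *: W + Z).
Proof.
move=> [Ws [c [d [ac cd db W0]]] Wg] [Zs [c' [d' [ac' cd' db' Z0]]] Zg]; split.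
- have h := smoothZ (@smooth_cst _ _ (k : R)) Ws.
  exact: (smoothD h Zs).
(* The smallest interval containing both supporting intervals still stays away from the
   endpoints. *)
- exists (Num.min c c'), (Num.max d d'); split.
  + by rewrite lt_min ac.
  + by rewrite gt_min !lt_max cd.
  + by rewrite gt_max db.
  + move=> x; rewrite gt_min lt_max negb_and !negb_or => h.
    have {}h : ~~ (c < x < d) /\ ~~ (c' < x < d').
      by case/orP: h => /andP[/negbTE -> /negbTE ->]; rewrite ?andbF.
    have -> : (k *: W + Z) x = k *: W x + Z x by [].
    by rewrite W0 ?Z0 ?scaler0 ?addr0//; case: h.
- move=> x xab; have -> : (k *: W + Z) x = k *: W x + Z x by [].
  by rewrite dotDl dotZl (Wg _ xab) (Zg _ xab) mulr0 addr0.
Qed.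

(** The coordinatewise primitives that vanish to the left of the support are taken; the zero
    integrals make them vanish again to its right within [a, b]. *)
Lemma tangential_test_primitive (a b : R) (g W : R -> 'cV[R]_n) : a < b ->
  tangential_test a b g W ->
  (forall i, \int[mu]_(x in `[a, b]) W x i 0 = 0) ->
  exists2 V, smooth_compact_support a b V & V^`() = W.
Proof.
move=> ab [Ws [c [d [ac cd db W0]]] Wg] IW.
have Wis i : smooth (fun x => W x i 0) := (smooth_cV W).1 Ws i.
have Wi0 i x : x < c -> W x i 0 = 0.
  by move=> xc; rewrite W0 ?mxE// negb_and -leNgt ltW.
have prim i := primitive (smooth_continuous (Wis i)) (Wi0 i).
pose F i := projT1 (cid (prim i)).
have [dF F0] : (forall i (x : R), is_derive x 1 (F i) (W x i 0)) /\
    forall i x, x < c -> F i x = 0.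
  by split=> i; have [] := projT2 (cid (prim i)).
pose V x : 'cV[R]_n := \col_i F i x.
have dV (x : R) : is_derive x 1 V (W x).
  apply/is_derive_cV => i; have -> : (fun y => V y i 0) = F i.
    by apply/funext => y; rewrite mxE.
  exact: dF.
have VW : V^`() = W by apply/funext => x; exact: is_derive1E.
exists V; last exact: VW.
have Fs i : smooth (F i) := smooth_primitive (dF i) (Wis i).
have Fb i : F i b = 0.
  have := IW i.
  rewrite (Rintegral_derive ab (smooth_continuous (Wis i)) (dF i)).
  by rewrite (F0 i a ac) subr0.
(* On [d, b] the primitive has zero derivative, so it keeps the value 0 it takes at [b]. *)
have Fd i x : d <= x <= b -> F i x = 0.
  move=> xdb.
  have H := @derive1_0_cst_itv R d b (F i) (Fs i).
  have D y : d <= y <= b -> (F i)^`() y = 0.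
    by move=> /andP[dy _]; rewrite (is_derive1E (dF i y)) W0 ?mxE// negb_and -!leNgt dy orbT.
  by rewrite (H D x xdb) -(H D b) ?Fb// ltW//=.
split; first exact: (smooth_primitive dV Ws).
apply: (@subset_trans _ [set` `[c, d]]).
  have cl : closed [set` `[c, d]] by exact: interval_closed.
  rewrite [X in _ `<=` X](closure_id _).1//; apply: closure_subset.
  move=> x [/andP[ax xb] /eqP Vx]; rewrite /= in_itv/=; apply/andP; split.
    by rewrite leNgt; apply/negP => xc; apply: Vx; apply/colP => i; rewrite !mxE F0.
  rewrite leNgt; apply/negP => dx; apply: Vx; apply/colP => i.
  by rewrite !mxE Fd// ltW.
by move=> x; rewrite /= !in_itv/= => /andP[cx xd]; rewrite (lt_le_trans ac)//= (le_lt_trans xd).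
Qed.

End elastic.

(** * From criticality to the elastic equation *)

Section euler_lagrange.
Context {R : realType} {n : nat}.
Notation mu := (@lebesgue_measure R).

(* Du Bois-Reymond: the first variation is a functional of W = V' that vanishes
   wherever the n functionals [\int W_i] do, hence is a combination of them. *)
Lemma elastic_multiplier (a b : R) (rho : R -> R) (g : R -> 'cV[R]_n) : a < b ->
  smooth rho -> is_elastic a b rho g ->
  exists v : 'cV[R]_n, forall W, tangential_test a b g W ->
    \int[mu]_(x in `[a, b]) (rho x * dot (g^`(2) x) (W^`() x)) =
    \int[mu]_(x in `[a, b]) dot v (W x).
Proof.
move=> ab rs el; have gs := el.1.1.1.
have Ts1 : smooth g^`(2) := smooth_derive1 (smooth_derive1 gs).
pose f (i : 'I_n) (W : R -> 'cV[R]_n) := \int[mu]_(x in `[a, b]) W x i 0.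
pose l (W : R -> 'cV[R]_n) :=
  \int[mu]_(x in `[a, b]) (rho x * dot (g^`(2) x) (W^`() x)).
have fc i W : tangential_test a b g W -> continuous (fun x => W x i 0).
  by move=> [Ws _ _]; exact: (smooth_continuous ((smooth_cV W).1 Ws i)).
have [||||v Hv] := @functional_span R (R -> 'cV[R]_n) n (tangential_test a b g) f l.
- by move=> c W Z; exact: tangential_test_linear.
- move=> i c W Z XW XZ; rewrite /f -(RintegralZD a b c (fc i W XW) (fc i Z XZ)).
  by apply: eq_Rintegral => x _; rewrite !mxE.
- move=> c W Z [Ws _ _] [Zs _ _]; rewrite /l.
  have lc (Y : R -> 'cV[R]_n) : smooth Y ->
      continuous (fun x => rho x * dot (g^`(2) x) (Y^`() x)).
    by move=> Ys; exact: (smooth_continuous (smoothM rs (smooth_dot Ts1 (smooth_derive1 Ys)))).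
  rewrite -(RintegralZD a b c (lc W Ws) (lc Z Zs)).
  apply: eq_Rintegral => x _.
  have -> : (c *: W + Z)^`() x = c *: W^`() x + Z^`() x.
    have d := is_deriveD (is_deriveZ c (smooth_is_derive x Ws)) (smooth_is_derive x Zs).
    exact: (is_derive1E d).
  move: (W^`() x) (Z^`() x) (g^`(2) x) => w z t.
  by rewrite dotDr dotZr; ring.
(* A test field with zero integrals is the derivative of an admissible variation, on which the first
   variation vanishes. *)
- move=> W XW W0.
  have [V Vsupp VW] := tangential_test_primitive ab XW W0.
  have Vg x : a <= x <= b -> dot (V^`() x) (g^`() x) = 0.
    by rewrite VW; case: XW => _ _; exact.
  have := elastic_critical ab rs el Vsupp Vg.
  have -> : V^`(2) = W^`() by rewrite -VW.
  exact.
exists (\col_i v i) => W XW; rewrite -/(l W) Hv//.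
have [_ <-] := Rintegral_lin_comb a b v (fun i => fc i W XW).
by apply: eq_Rintegral => x _; apply: eq_bigr => i _; rewrite mxE.
Qed.

(** Integration by parts in the multiplier identity yields zero integral of <h, W> for h = (rho T')'
    + v and every test field W. Localized multiples of the normal part [Q] of h then force [Q] to
    vanish inside ]a, b[, and continuity reaches the endpoints. *)
Lemma elastic_elastic_equation (a b : R) (rho : R -> R) (g : R -> 'cV[R]_n) :
  a < b -> smooth rho -> is_elastic a b rho g ->
  exists v, elastic_equation a b rho g^`() v.
Proof.
move=> ab rs el; have [v vE] := elastic_multiplier ab rs el.
have [[[gs _] g1] _] := el.
have Ts : smooth g^`() := smooth_derive1 gs.
have Ts1 : smooth g^`()^`() := smooth_derive1 Ts.
have Ts2 : smooth g^`()^`()^`() := smooth_derive1 Ts1.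
have T1 x : a <= x <= b -> dot (g^`() x) (g^`() x) = 1.
  by move=> xab; apply: enorm_eq1; exact: g1.
pose h0 x := rho x *: g^`()^`()^`() x + rho^`() x *: g^`()^`() x.
have h0s : smooth h0 := smoothD (smoothZ rs Ts2) (smoothZ (smooth_derive1 rs) Ts1).
pose h x := h0 x + v.
have hs : smooth h := smoothD h0s (@smooth_cst _ _ v).
pose Q x := h x - dot (h x) (g^`() x) *: g^`() x.
have Qs : smooth Q := smoothD hs (smoothN (smoothZ (smooth_dot hs Ts) Ts)).
(* Testing with W = phi Q turns the multiplier identity into \int phi |Q|^2 = 0. *)
have Qoo x : a < x < b -> Q x = 0.
  move=> /andP[ax xb].
  pose c := (a + x) / 2; pose d := (x + b) / 2.
  have ac : a < c by rewrite /c; lra.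
  have cx : c < x by rewrite /c; lra.
  have xd : x < d by rewrite /d; lra.
  have db : d < b by rewrite /d; lra.
  have cd := lt_trans cx xd.
  have [phi [phis phi0 phigt phiN]] := exists_bump cd.
  pose W y := phi y *: Q y.
  have Ws : smooth W := smoothZ phis Qs.
  have XW : tangential_test a b g W.
    split; first exact: Ws.
      exists c, d; split; [exact: ac|exact: cd|exact: db|].
      by move=> y yN; rewrite /W phiN// scale0r.
    by move=> y yab; rewrite dotZl (normal_part_dot (h y) (T1 y yab)).1 mulr0.
  have Wout y : ~~ (c < y < d) -> W y = 0 by move=> yN; rewrite /W phiN// scale0r.
  (* The boundary term of the integration by parts; it is 0 at [a] and [b], where [W] vanishes. *)
  pose F y := rho y * dot (g^`()^`() y) (W y).
  have Fs : smooth F := smoothM rs (smooth_dot Ts1 Ws).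
  have dF (y : R) : is_derive y 1 F
      (rho y * dot (g^`()^`() y) (W^`() y) + dot (h0 y) (W y)).
    have D := is_deriveM (smooth_is_derive y rs)
      (is_derive_dot (smooth_is_derive y Ts1) (smooth_is_derive y Ws)).
    apply: (is_derive_eq D); rewrite /h0 /GRing.scale/=.
    move: (W y) (W^`() y) (g^`()^`() y) (g^`()^`()^`() y) => w w1 t1 t2.
    by rewrite dotDl 2!dotZl; ring.
  have IF : \int[mu]_(y in `[a, b]) F^`() y = 0.
    rewrite (Rintegral_derive ab (smooth_continuous (smooth_derive1 Fs))
      (fun y => smooth_is_derive y Fs)).
    have Fz y : ~~ (c < y < d) -> F y = 0.
      move=> yN; apply: (etrans (congr1 (fun w => rho y * dot (g^`()^`() y) w) (Wout y yN))).
      by rewrite dot0r mulr0.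
    have aN : ~~ (c < a < d) by rewrite negb_and -!leNgt (ltW ac).
    have bN : ~~ (c < b < d) by rewrite negb_and -!leNgt (ltW db) orbT.
    by rewrite (Fz a aN) (Fz b bN) subrr.
  pose k1 y := rho y * dot (g^`(2) y) (W^`() y).
  have k1s : smooth k1 := smoothM rs (smooth_dot Ts1 (smooth_derive1 Ws)).
  have vWs : smooth (fun y => dot v (W y)) := smooth_dot (@smooth_cst _ _ v) Ws.
  have hWs : smooth (fun y => dot (h y) (W y)) := smooth_dot hs Ws.
  have IhW : \int[mu]_(y in `[a, b]) dot (h y) (W y) = 0.
    (* <h, W> = F' - rho <T', W'> + <v, W>: the first integral is 0 and the other two cancel by the
       multiplier identity. The coefficients -1 and 1 fit the shape of [RintegralZD]. *)
    have -> : \int[mu]_(y in `[a, b]) dot (h y) (W y) =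
        \int[mu]_(y in `[a, b]) (-1 * k1 y + (1 * dot v (W y) + F^`() y)).
      apply: eq_Rintegral => y _; rewrite (is_derive1E (dF y)) dotDl.
      by rewrite -[k1 y]/(rho y * dot (g^`()^`() y) (W^`() y)); ring.
    have c1 : continuous (fun y => 1 * dot v (W y) + F^`() y).
      exact: (smooth_continuous (smoothD (smoothM (@smooth_cst _ _ (1 : R)) vWs)
        (smooth_derive1 Fs))).
    rewrite (RintegralZD _ _ _ (smooth_continuous k1s) c1).
    rewrite (RintegralZD _ _ _ (smooth_continuous vWs)
      (smooth_continuous (smooth_derive1 Fs))) IF.
    by rewrite -(vE W XW) -/k1; ring.
  have hW0 y : y < c -> dot (h y) (W y) = 0.
    by move=> yc; rewrite Wout ?dot0r// negb_and -leNgt (ltW yc).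
  have hWge y : a <= y <= b -> 0 <= dot (h y) (W y).
    move=> yab; rewrite /W dotZr (normal_part_dot (h y) (T1 y yab)).2.
    by rewrite mulr_ge0 ?dot_ge0.
  have xab : a < x < b by rewrite ax.
  have := Rintegral_ge0_eq0 ab (smooth_continuous hWs) hW0 hWge IhW xab.
  have xab' : a <= x <= b by rewrite !ltW.
  rewrite /W dotZr (normal_part_dot (h x) (T1 x xab')).2 => /eqP.
  by rewrite mulf_eq0 gt_eqF ?phigt ?cx//= dot_eq0 => /eqP.
(* The sign changes because the elastic equation has the constant vector on its right-hand side. *)
exists (- v) => x xab.
have Q0 : Q x = 0.
  apply/colP => i; rewrite [RHS]mxE.
  apply: (eq0_itvcc ab (smooth_continuous ((smooth_cV Q).1 Qs i))) xab.
  by move=> y yab; rewrite Qoo// mxE.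
have t01 := dot_tangent_derive1 ab Ts T1 xab.
move: Q0; rewrite /Q /h /h0.
change (g^`()^`(2) x) with (g^`()^`()^`() x).
move: (g^`() x) (g^`()^`() x) (g^`()^`()^`() x) t01 => t t1 t2 t01.
rewrite 2!dotDl 2!dotZl (dotC t1) t01 dotNl mulr0 addr0 => Q0.
apply/eqP; rewrite -subr_eq0 -Q0; apply/eqP/colP => i; rewrite !mxE; ring.
Qed.

End euler_lagrange.

(* The ambient space is R^n with n = m.+1 >= 2. *)
Theorem theorem5p2 (R : realType) (m : nat) (hm : (1 <= m)%N)
    (a b : R) (hab : a < b)
    (g : R -> 'cV[R]_m.+1) (hg : arclength_parametrized a b g)
    (T : R -> 'cV[R]_m.+1) (hT : T = derive1 g)
    (rho : R -> R) (hrho : is_stiffness a b rho)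
    (kappa : R -> 'cV[R]_m) (hkappa : is_curvature_function a b g kappa) :
  (is_elastic a b rho g <->
   exists v : 'cV[R]_m.+1, elastic_equation a b rho T v)
  /\
  (is_elastic a b rho g ->
   [/\ (* the two expressions for the multiplier agree *)
       forall v : 'cV[R]_m.+1, elastic_equation a b rho T v ->
         (forall x, a <= x <= b ->
           2^-1 * rho x * dot (derive1 T x) (derive1 T x) - dot v (T x)
           = 2^-1 * rho x * dot (kappa x) (kappa x) - dot v (T x)),
       (* characterization of the pointwise multipliers *)
       forall L : R -> R, smooth L ->
         (is_pointwise_multiplier a b rho g L <->
          exists v : 'cV[R]_m.+1,
            elastic_equation a b rho T v /\
            (forall x, a <= x <= b ->
              L x = 2^-1 * rho x * dot (derive1 T x) (derive1 T x) - dot v (T x)))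
     & (* constant stiffness *)
       (exists c : R, (forall x, a <= x <= b -> rho x = c)) ->
       forall L : R -> R, is_pointwise_multiplier a b rho g L ->
         exists c : R, (forall x, a <= x <= b -> L x = c)]).
Proof.
have [rs _] := hrho; have gs := hg.1.1.
have Ts : smooth (derive1 g) := smooth_derive1 gs.
have T1 x : a <= x <= b -> dot (derive1 g x) (derive1 g x) = 1.
  by move=> xab; apply: enorm_eq1; exact: hg.2.
rewrite hT; split.
  split=> [|[v]]; first exact: elastic_elastic_equation.
  exact: elastic_equation_elastic.
move=> _; split.
- move=> v _ x xab; congr (_ * _ - _).
  exact: dot_curvature hg hkappa x xab.
- move=> L Ls; split=> [[_ EL0]|H]; first exact: (EL_eq0P hab rs Ts T1 Ls).1.
  by split; [exact: Ls|exact: (EL_eq0P hab rs Ts T1 Ls).2].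
- move=> [c rc] L [Ls EL0]; exists (L a).
  exact: (multiplier_cst hab rs Ts T1 Ls rc EL0).
Qed.
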